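(* Fix $n>2$. Consider $\mathfrak{S}_n$ as a poset under the Bruhat order, and fix $k\in\{1,\dots,n-1\}$. The number of boolean intervals (equivalently, intervals that are modular lattices, or intervals that are distributive lattices) of the form $[\sigma_k,w]$, with $w\in\mathfrak{S}_n$, is $$t(n,k)=\begin{cases}4F_{2n-4} & \text{if } k\in\{1,n-1\},\\ 16\,F_{2k-2}\,F_{2(n-k)-2} & \text{if } 2\le k\le n-2,\end{cases}$$ where $F_i$ is the $i$th Fibonacci number.
   Context: $\mathfrak{S}_n$ is the symmetric group with Coxeter generators $\sigma_1,\dots,\sigma_{n-1}$, where $\sigma_i$ is the transposition swapping $i$ and $i+1$. A reduced decomposition of $w$ is a word of minimal length in these generators with product $w$. Bruhat order: $v\le w$ if some reduced decomposition of $v$ is a (not necessarily contiguous) subword of a reduced decomposition of $w$. $[v,w]=\{u: v\le u\le w\}$ for $v\le w$. A poset is boolean if it is isomorphic to the poset of all subsets of a finite set, ordered by inclusion. Fibonacci numbers are indexed by $F_0=0$, $F_1=1$. *)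

(* Defs.v *)
From HB Require Import structures.
From mathcomp Require Import all_boot all_order all_fingroup.
From mathcomp Require Import boolp.

Set Implicit Arguments.
Unset Strict Implicit.
Unset Printing Implicit Defensive.

Fixpoint fib (n : nat) : nat :=
  match n with
  | 0 => 0
  | 1 => 1
  | (m.+1 as p).+1 => fib p + fib m
  end.

(* {set X} is ordered by inclusion. *)
Import Order.DefaultSetSubsetOrder.

Section SymmetricGroup.

Variable n : nat.

Lemma coxeter_ltn (i : 'I_n.-1) : (i.+1 < n)%N.
Proof. by rewrite -ltn_predRL. Qed.

(* Points and generators are numbered from 0: [sigma i] swaps the points i and
   i.+1 of {0, ..., n-1}, so it is the generator written sigma_{i+1} when both
   are numbered from 1. *)
Definition sigma (i : 'I_n.-1) : 'S_n :=
  tperm (Ordinal (ltnW (coxeter_ltn i))) (Ordinal (coxeter_ltn i)).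

(* MathComp composes permutations from left to right.  With the opposite
   convention all words are reversed, which does not change the Bruhat order. *)
Definition word_prod (s : seq 'I_n.-1) : 'S_n := (\prod_(i <- s) sigma i)%g.

Definition reduced_decomposition (w : 'S_n) (s : seq 'I_n.-1) : Prop :=
  word_prod s = w /\ forall s', word_prod s' = w -> (size s <= size s')%N.

Definition bruhat : rel 'S_n := fun v w =>
  `[< exists s t, [/\ reduced_decomposition v s, reduced_decomposition w t
                    & subseq s t] >].

Definition bruhat_interval (v w : 'S_n) : {set 'S_n} :=
  [set u | bruhat v u && bruhat u w].

Definition bruhat_intervals_from (v : 'S_n) : {set {set 'S_n}} :=
  [set bruhat_interval v w | w : 'S_n & bruhat v w].

End SymmetricGroup.

(* [le] restricted to [I] is isomorphic, as an ordered set, to [L]. *)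
Definition order_isomorphic d (L : porderType d) (T : finType) (le : rel T)
    (I : {set T}) : Prop :=
  exists f : L -> T,
    [/\ injective f,
        forall x, x \in I <-> exists a, f a = x
      & forall a b, (a <= b)%O = le (f a) (f b)].

Definition is_boolean (T : finType) (le : rel T) (I : {set T}) : Prop :=
  exists X : finType, order_isomorphic {set X} le I.

Definition is_distributive_lattice (T : finType) (le : rel T) (I : {set T}) :
    Prop :=
  exists (d : Order.disp_t) (L : distrLatticeType d), order_isomorphic L le I.

Definition modular_law d (L : latticeType d) : Prop :=
  forall x y z : L, (x <= z)%O -> (x `|` (y `&` z) = (x `|` y) `&` z)%O.

Definition is_modular_lattice (T : finType) (le : rel T) (I : {set T}) : Prop :=
  exists (d : Order.disp_t) (L : latticeType d),
    modular_law L /\ order_isomorphic L le I.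

(* Here [k] is numbered from 1, as in sigma_1, ..., sigma_{n-1}. *)
Definition boolean_interval_number (n k : nat) : nat :=
  if (k == 1) || (k == n.-1) then 4 * fib (2 * n - 4)
  else 16 * fib (2 * k - 2) * fib (2 * (n - k) - 2).

(* Main.v *)
(** The Bruhat order is compared through the numbers rk w i y of positions
    before i carrying a value at least y; with the lifting property this gives
    the subword description in both directions.

    If s_i s_k is not below v, then [s_k, s_i v] is two copies of [s_k, v], and
    symmetrically on the right; such extensions build boolean intervals from
    [s_k, s_k].  Conversely, a modular interval [s_k, w] contains neither
    s_k s_{k+1} s_{k-1} s_k, whose interval above s_k has rank 3 and violates the
    modular law, nor s_k t or t s_k for t = s_j s_{j+1} s_j with k different
    from j and j+1, since two atoms below these have no join.  A permutation
    avoiding these patterns comes from s_k by such extensions, the last of which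
    involve the last moved point or, by symmetry, the first.

    Counting w by its last moved point yields c(r+1) + c(r-1) = 3 c(r), r > 1, for
    the number c(r) of contributions of the r letters on one side of s_k, with
    c(1) = 4 and c(2) = 12, so c(r) = 4 F_{2r}; the two sides are independent. *)

Require Import Defs.
From mathcomp Require Import all_boot all_order all_fingroup.
From mathcomp Require Import boolp zify.

Set Implicit Arguments.
Unset Strict Implicit.
Unset Printing Implicit Defensive.

(** * Adjacent transpositions of natural numbers and rank counts *)

Section Swaps.

Definition swap (i a : nat) : nat :=
  if a == i then i.+1 else if a == i.+1 then i else a.

Lemma swap_cases i a : [\/ a = i /\ swap i a = i.+1, a = i.+1 /\ swap i a = i
  | [/\ a <> i, a <> i.+1 & swap i a = a]].
Proof.
rewrite /swap; case: eqP => [->|ai]; first by constructor 1.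
by case: eqP => [->|ai']; [constructor 2 | constructor 3].
Qed.

Lemma swapL i : swap i i = i.+1.
Proof. by rewrite /swap eqxx. Qed.

Lemma swapR i : swap i i.+1 = i.
Proof. by case: (swap_cases i i.+1) => -[]; lia. Qed.

Lemma swapD i a : a <> i -> a <> i.+1 -> swap i a = a.
Proof. by case: (swap_cases i a) => -[]. Qed.

Definition rk (f : nat -> nat) (i y : nat) : nat := \sum_(a < i) (y <= f a).

Lemma rk0 f y : rk f 0 y = 0.
Proof. by rewrite /rk big_ord0. Qed.

Lemma rkS f i y : rk f i.+1 y = rk f i y + (y <= f i).
Proof. by rewrite /rk big_ord_recr. Qed.

Lemma eq_rk f g i y : (forall a, a < i -> f a = g a) -> rk f i y = rk g i y.
Proof. by move=> fg; apply: eq_bigr => a _; rewrite fg. Qed.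

(** A prefix of length other than x + 1 contains both of the positions x and x + 1 or neither, so
    exchanging them only permutes its values. *)
Lemma rk_swap_neq f x i y : i != x.+1 -> rk (f \o swap x) i y = rk f i y.
Proof.
move=> ix; have [ix'|xi] := ltnP i x.+1.
  by apply: eq_rk => a ai; rewrite /= swapD //; lia.
have -> : i = (i - x.+2) + x.+2 by lia.
elim: (i - _) => [|d IHd]; last by rewrite !addSn !rkS IHd /= swapD //; lia.
rewrite add0n !rkS /= swapL swapR (@eq_rk (f \o swap x) f); first by rewrite addnAC.
by move=> a ax; rewrite /= swapD //; lia.
Qed.

Lemma rk_swap f x y : rk (f \o swap x) x.+1 y = rk f x y + (y <= f x.+1).
Proof. by rewrite rkS rk_swap_neq /= ?swapL //; lia. Qed.

Lemma rk_mono f i j y : i <= j -> rk f i y <= rk f j y.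
Proof. by move/subnK <-; elim: (j - i) => // d IH; rewrite addSn rkS; lia. Qed.

Lemma rk_anti f i y z : y <= z -> rk f i z <= rk f i y.
Proof. by move=> yz; apply: leq_sum => a _; lia. Qed.

Lemma rk_gt0 f i y : reflect (exists2 a, a < i & y <= f a) (0 < rk f i y).
Proof.
elim: i => [|i IHi]; first by rewrite rk0; constructor; case.
rewrite rkS; have [yf|fy] := leqP y (f i).
  by rewrite addn1; constructor; exists i.
rewrite addn0; apply: (iffP IHi) => -[a ai ya]; exists a => //; first by lia.
have [e|] := eqVneq a i; last by lia.
by subst a; lia.
Qed.

Lemma rk_eq0 f i y : (forall a, a < i -> f a < y) -> rk f i y = 0.
Proof.
move=> fy; apply/eqP; rewrite -leqn0 leqNgt; apply/rk_gt0 => -[a /fy]; lia.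
Qed.

End Swaps.

(** * The Bruhat order as comparison of ranks: lifting, length and subwords *)

Section Perms.

Variable n : nat.
Implicit Types u v w : 'S_n.

(** Extending by the identity makes positions plain numbers; every index from n - 1 on is then an
    ascent, so a descent lies in range by itself. *)
Definition pn w (a : nat) : nat := if insub a is Some i then val (w i) else a.

Lemma pn_ord w (i : 'I_n) : pn w i = w i.
Proof. by rewrite /pn valK. Qed.

Lemma pn_out w a : n <= a -> pn w a = a.
Proof. by rewrite /pn => na; case: insubP => // i; rewrite ltnNge na. Qed.

Lemma pn_lt w a : a < n -> pn w a < n.
Proof. by move=> an; rewrite -[a]/(nat_of_ord (Ordinal an)) pn_ord ltn_ord. Qed.

Lemma pnM v w a : pn (v * w)%g a = pn w (pn v a).
Proof.
have [an|na] := ltnP a n; last by rewrite !pn_out.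
by rewrite -[a]/(nat_of_ord (Ordinal an)) !pn_ord permM.
Qed.

Lemma pn1 a : pn 1%g a = a.
Proof.
have [an|na] := ltnP a n; last by rewrite !pn_out.
by rewrite -[a]/(nat_of_ord (Ordinal an)) !pn_ord perm1.
Qed.

Lemma pnK w : cancel (pn w) (pn w^-1%g).
Proof. by move=> a; rewrite -pnM mulgV pn1. Qed.

Lemma pnKV w : cancel (pn w^-1%g) (pn w).
Proof. by move=> a; rewrite -pnM mulVg pn1. Qed.

Lemma pn_inj w : injective (pn w).
Proof. exact: can_inj (pnK w). Qed.

Lemma eq_pn v w : pn v =1 pn w -> v = w.
Proof. by move=> vw; apply/permP => i; apply: ord_inj; rewrite -!pn_ord. Qed.

(** Generators indexed by plain numbers, with the identity outside the range. *)
Definition sg (i : nat) : 'S_n :=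
  if insub i : option 'I_n.-1 is Some j then sigma j else 1%g.

Lemma sigma_sg (j : 'I_n.-1) : sigma j = sg j.
Proof. by rewrite /sg valK. Qed.

Lemma pn_sg i : i.+1 < n -> pn (sg i) =1 swap i.
Proof.
move=> iln a; have iln' : i < n.-1 by lia.
rewrite -[i]/(nat_of_ord (Ordinal iln')) -sigma_sg.
have [an|na] := ltnP a n; last by rewrite pn_out // swapD //=; lia.
rewrite -[a]/(nat_of_ord (Ordinal an)) pn_ord /sigma.
case: tpermP => [->|->|/eqP h1 /eqP h2] /=; first by rewrite swapL.
  by rewrite swapR.
by rewrite -!val_eqE /= in h1 h2; rewrite swapD //; apply/eqP.
Qed.

Lemma sgK i : (sg i * sg i = 1)%g.
Proof.
rewrite /sg; case: insubP => [j _ _|]; last by rewrite mulg1.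
exact: tperm2.
Qed.

Lemma sgV i : ((sg i)^-1 = sg i)%g.
Proof. by apply/eqP; rewrite eq_invg_mul sgK. Qed.

(** The rank-matrix form of the Bruhat order; [bruhatP] proves the agreement. *)
Definition ler v w := forall i y, rk (pn v) i y <= rk (pn w) i y.

Lemma ler_refl w : ler w w.
Proof. by []. Qed.

Lemma ler_trans v u w : ler u v -> ler v w -> ler u w.
Proof. by move=> uv vw i y; apply: leq_trans (uv i y) (vw i y). Qed.

(** Ranks determine a permutation: rows a and a + 1 tell, for every y, whether the value at a is at
    least y. *)
Lemma ler_anti v w : ler v w -> ler w v -> v = w.
Proof.
move=> vw wv; apply: eq_pn => a.
have e i y : rk (pn v) i y = rk (pn w) i y by have := vw i y; have := wv i y; lia.
have := e a.+1 (pn v a); have := e a.+1 (pn w a); rewrite !rkS !e; lia.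
Qed.

Lemma pn_sgM i w : i.+1 < n -> pn (sg i * w)%g =1 pn w \o swap i.
Proof. by move=> iln a; rewrite pnM pn_sg. Qed.

Lemma rk_sgM_neq x w i y : x.+1 < n -> i != x.+1 ->
  rk (pn (sg x * w)%g) i y = rk (pn w) i y.
Proof.
by move=> xn ix; rewrite (eq_rk _ (fun a _ => pn_sgM w xn a)) rk_swap_neq.
Qed.

Lemma rk_sgM x w y : x.+1 < n ->
  rk (pn (sg x * w)%g) x.+1 y = rk (pn w) x y + (y <= pn w x.+1).
Proof. by move=> xn; rewrite (eq_rk _ (fun a _ => pn_sgM w xn a)) rk_swap. Qed.

Lemma pn_neqS w x : pn w x != pn w x.+1.
Proof. by apply/eqP => /pn_inj; lia. Qed.

Lemma asc_or_desc w x : pn w x < pn w x.+1 \/ pn w x.+1 < pn w x.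
Proof. by have := pn_neqS w x; lia. Qed.

Lemma ler_sgM x w : x.+1 < n -> pn w x < pn w x.+1 -> ler w (sg x * w)%g.
Proof.
move=> xn wx i y; have [->|ix] := eqVneq i x.+1; last by rewrite rk_sgM_neq.
by rewrite rk_sgM // rkS; lia.
Qed.

Lemma ler_sgM_desc x w : x.+1 < n -> pn w x.+1 < pn w x -> ler (sg x * w)%g w.
Proof.
move=> xn wx i y; have [->|ix] := eqVneq i x.+1; last by rewrite rk_sgM_neq.
by rewrite rk_sgM // rkS; lia.
Qed.

(* On row x+1, passing to the larger of [w] and [sg x * w] replaces the rank by
   min (A + 1) C, and to the smaller one by max A (C - 1), where A and C are the
   ranks on rows x and x+2; both expressions are monotone in A and C. *)
Lemma lift_up x v w : x.+1 < n -> pn w x.+1 < pn w x -> ler v w ->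
  ler (sg x * v)%g w.
Proof.
move=> xn wx vw i y; have [->|ix] := eqVneq i x.+1; last by rewrite rk_sgM_neq.
have := vw x y; have := vw x.+1 y; have := vw x.+2 y; rewrite rk_sgM // !rkS; lia.
Qed.

Lemma lift_down x v w : x.+1 < n -> pn v x < pn v x.+1 -> ler v w ->
  ler v (sg x * w)%g.
Proof.
move=> xn vx vw i y; have [->|ix] := eqVneq i x.+1; last by rewrite rk_sgM_neq.
have := vw x y; have := vw x.+1 y; have := vw x.+2 y; rewrite rk_sgM // !rkS; lia.
Qed.

Lemma lift_both x v w : x.+1 < n -> pn v x.+1 < pn v x -> pn w x.+1 < pn w x ->
  ler v w -> ler (sg x * v)%g (sg x * w)%g.
Proof.
move=> xn vx wx vw i y; have [->|ix] := eqVneq i x.+1; last by rewrite !rk_sgM_neq.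
have := vw x y; have := vw x.+2 y; rewrite !rk_sgM // !rkS; lia.
Qed.

Lemma lift_both_asc x v w : x.+1 < n -> pn w x < pn w x.+1 -> ler v w ->
  ler (sg x * v)%g (sg x * w)%g.
Proof.
move=> xn wx vw i y; have [->|ix] := eqVneq i x.+1; last by rewrite !rk_sgM_neq.
have := vw x y; have := vw x.+2 y; rewrite !rk_sgM // !rkS; lia.
Qed.

(** The number of inversions, grouped by their right end a; by [reducedP] it is the Coxeter
    length. *)
Definition ell w : nat := \sum_(a < n) rk (pn w) a (pn w a).

(** Only the terms at x and x + 1 change: they trade places, and the larger value, now in front,
    adds one inversion. *)
Lemma ell_sgM x w : x.+1 < n -> pn w x < pn w x.+1 -> ell (sg x * w)%g = (ell w).+1.
Proof.
move=> xn wx; have xn' := ltnW xn; rewrite /ell.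
rewrite (bigD1 (Ordinal xn)) //= (bigD1 (Ordinal xn')) /=; last by rewrite -val_eqE /=; lia.
rewrite [in RHS](bigD1 (Ordinal xn)) //= [in RHS](bigD1 (Ordinal xn')) /=; last first.
  by rewrite -val_eqE /=; lia.
rewrite rk_sgM // rk_sgM_neq //; last by lia.
rewrite !pn_sgM //= rkS swapL swapR.
rewrite (eq_bigr (fun i : 'I_n => rk (pn w) i (pn w i))); first by lia.
move=> i /andP[]; rewrite -!val_eqE /= => h1 h2.
by rewrite rk_sgM_neq // pn_sgM //= swapD //; lia.
Qed.

Lemma ell1 : ell 1%g = 0.
Proof.
by rewrite /ell big1 // => a _; apply: rk_eq0 => b; rewrite !pn1.
Qed.

Lemma ell_sgM_desc x w : x.+1 < n -> pn w x.+1 < pn w x -> ell w = (ell (sg x * w)%g).+1.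
Proof.
move=> xn wx; rewrite -(@ell_sgM x) //; first by rewrite mulgA sgK mul1g.
by rewrite !pn_sgM //= swapL swapR.
Qed.

Lemma desc_ltn x w : pn w x.+1 < pn w x -> x.+1 < n.
Proof.
rewrite ltnNge => h; rewrite ltnNge; apply: contra h => nx; rewrite (pn_out _ nx).
have [xn|nx'] := ltnP x n; last by rewrite pn_out.
by have := pn_lt w xn; lia.
Qed.

Lemma exists_desc w : w != 1%g -> exists x, pn w x.+1 < pn w x.
Proof.
move=> w1; apply: contrapT => nd; case/eqP: w1; apply: eq_pn => a; rewrite pn1.
have inc b : pn w b < pn w b.+1.
  by case: (asc_or_desc w b) => // h; case: nd; exists b.
have ge b : b <= pn w b by elim: b => // b IH; apply: leq_ltn_trans IH (inc b).
apply/eqP; rewrite eqn_leq ge andbT leqNgt; apply/negP => wa.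
(* A strict excess at a would persist at all later positions, but from n on [pn w] is the
   identity. *)
have gt b : a <= b -> b < pn w b.
  by move/subnK <-; elim: (b - a) => // d IH; rewrite addSn; apply: leq_ltn_trans IH (inc _).
by have := gt (maxn a n) (leq_maxl _ _); rewrite pn_out ?leq_maxr ?ltnn.
Qed.

Lemma word_prod_cons (x : 'I_n.-1) s : word_prod (x :: s) = (sg x * word_prod s)%g.
Proof. by rewrite /word_prod big_cons sigma_sg. Qed.

Lemma ell_word (s : seq 'I_n.-1) : ell (word_prod s) <= size s.
Proof.
elim: s => [|x s IHs]; first by rewrite /word_prod big_nil ell1.
rewrite word_prod_cons /=; set w := word_prod s in IHs *.
have xn : x.+1 < n by have := ltn_ord x; lia.
case: (asc_or_desc w x) => wx; first by rewrite ell_sgM.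
by have := ell_sgM_desc xn wx; lia.
Qed.

Lemma exists_word w : exists2 s : seq 'I_n.-1, word_prod s = w & size s = ell w.
Proof.
have [N] := ubnP (ell w); elim: N w => // N IHN w wN.
have [->|/exists_desc [x wx]] := eqVneq w 1%g.
  by exists [::]; rewrite ?ell1 // /word_prod big_nil.
have xn := desc_ltn wx; have e := ell_sgM_desc xn wx.
have [|s sw ss] := IHN (sg x * w)%g; first by lia.
have xn' : x < n.-1 by lia.
exists (Ordinal xn' :: s); last by rewrite /= ss e.
by rewrite word_prod_cons sw mulgA sgK mul1g.
Qed.

Lemma reducedP w (s : seq 'I_n.-1) :
  reduced_decomposition w s <-> word_prod s = w /\ size s = ell w.
Proof.
split=> [[sw ms]|[sw ms]]; split=> //; last by move=> s' s'w; rewrite ms -s'w ell_word.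
have [t tw ts] := exists_word w; by have := ms t tw; have := ell_word s; rewrite sw; lia.
Qed.

Lemma ell_desc_word x w (s : seq 'I_n.-1) : word_prod (x :: s) = w ->
  size (x :: s) = ell w -> pn w x.+1 < pn w x /\ word_prod s = (sg x * w)%g.
Proof.
rewrite word_prod_cons => <- /= ss.
have xn : x.+1 < n by have := ltn_ord x; lia.
split; last by rewrite mulgA sgK mul1g.
have := ell_word s; rewrite !pn_sgM //= swapL swapR.
case: (asc_or_desc (word_prod s) x) => // wx; have := ell_sgM_desc xn wx; lia.
Qed.

(** Induction on [t]: its first letter is a descent of its product because [t] is reduced, so
    lifting lets [s] use that letter or skip it. *)
Lemma ler_subword (s t : seq 'I_n.-1) : size t = ell (word_prod t) ->
  subseq s t -> ler (word_prod s) (word_prod t).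
Proof.
elim: t s => [|x t IHt] s ts; first by rewrite subseq0 => /eqP ->.
have [dx te] := ell_desc_word (erefl _) ts.
have xn : x.+1 < n by have := ltn_ord x; lia.
have e := ell_sgM_desc xn dx.
have ts' : size t = ell (word_prod t) by rewrite te -[size t]/(size (x :: t)).-1 ts e.
have wt : ler (word_prod t) (word_prod (x :: t)) by rewrite te; apply: ler_sgM_desc.
case: s => [|y s] /= st; first by apply: ler_trans wt; apply: IHt ts' _; apply: sub0seq.
case: eqP st => [->|_] st; last by apply: ler_trans wt; apply: IHt.
have := IHt s ts' st; rewrite [word_prod (x :: s)]word_prod_cons => h.
by apply: lift_up => //; apply: ler_trans h wt.
Qed.

Lemma ler1 w : ler 1%g w.
Proof.
have [N] := ubnP (ell w); elim: N w => // N IHN w wN.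
have [->//|/exists_desc [x wx]] := eqVneq w 1%g.
have xn := desc_ltn wx; apply: ler_trans (ler_sgM_desc xn wx).
by apply: IHN; rewrite ltnS in wN; rewrite (ell_sgM_desc xn wx) in wN.
Qed.

(** Induction on the length of [w]. A descent x of [w] gives the first letter of [t]; it is also the
    first letter of [s] if x is a descent of [v], and otherwise v is still below s_x w. *)
Lemma exists_subword v w : ler v w -> exists s t : seq 'I_n.-1,
  [/\ reduced_decomposition v s, reduced_decomposition w t & subseq s t].
Proof.
have red_cons (x : 'I_n.-1) u (s : seq 'I_n.-1) : pn u x.+1 < pn u x ->
    reduced_decomposition (sg x * u)%g s -> reduced_decomposition u (x :: s).
  move=> ux /reducedP [su ss]; apply/reducedP; split.
    by rewrite word_prod_cons su mulgA sgK mul1g.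
  by rewrite /= ss (ell_sgM_desc _ ux) // (desc_ltn ux).
have [N] := ubnP (ell w); elim: N v w => // N IHN v w wN vw.
have [w1|/exists_desc [x wx]] := eqVneq w 1%g.
  have v1 : v = 1%g by apply: ler_anti (ler1 v); rewrite -w1.
  by exists [::], [::]; split=> //; apply/reducedP; rewrite ?w1 ?v1 ell1 /word_prod big_nil.
have xn := desc_ltn wx; have e := ell_sgM_desc xn wx.
have xn' : x < n.-1 by lia.
case: (asc_or_desc v x) => vx.
  have [|s [t [sv tw st]]] := IHN v (sg x * w)%g _ (lift_down xn vx vw); first by lia.
  exists s, (Ordinal xn' :: t); split=> //; first exact: red_cons.
  exact: subseq_trans st (subseq_cons _ _).
have [|s [t [sv tw st]]] := IHN (sg x * v)%g (sg x * w)%g _ (lift_both xn vx wx vw).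
  by lia.
by exists (Ordinal xn' :: s), (Ordinal xn' :: t); split; rewrite /= ?eqxx //; apply: red_cons.
Qed.

Lemma bruhatP v w : reflect (ler v w) (bruhat v w).
Proof.
apply: (iffP (asboolP _)) => [[s [t [/reducedP [<- _] /reducedP [<- tt] st]]]|].
  exact: ler_subword.
exact: exists_subword.
Qed.

End Perms.

(** * Inversion and reversal of the generators as automorphisms of the Bruhat order *)

Section Symmetries.

Variable n : nat.
Implicit Types u v w : 'S_n.

(** A map of words that keeps sizes and subwords and realises an involution carries reduced
    decompositions to reduced decompositions. *)
Lemma bruhat_word_symmetry (phi : 'S_n -> 'S_n) (f : seq 'I_n.-1 -> seq 'I_n.-1) :
    involutive phi -> (forall s, size (f s) = size s) ->
    (forall s t, subseq s t -> subseq (f s) (f t)) ->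
    (forall s, word_prod (f s) = phi (word_prod s)) ->
  {mono phi : v w / bruhat v w}.
Proof.
move=> phiK fsize fsub fprod.
have red w s : reduced_decomposition w s -> reduced_decomposition (phi w) (f s).
  move=> [sw ms]; split=> [|s' s'w]; first by rewrite fprod sw.
  by rewrite fsize -(fsize s'); apply: ms; rewrite fprod s'w phiK.
have homo v w : bruhat v w -> bruhat (phi v) (phi w).
  move=> /asboolP [s [t [sv tw st]]]; apply/asboolP.
  by exists (f s), (f t); split; auto.
by move=> v w; apply/idP/idP => /homo //; rewrite !phiK.
Qed.

Lemma word_prod_rev (s : seq 'I_n.-1) : word_prod (rev s) = ((word_prod s)^-1)%g.
Proof.
rewrite /word_prod; elim: s => [|x s IHs]; first by rewrite !big_nil invg1.
by rewrite rev_cons -cats1 big_cat big_seq1 big_cons invMg -IHs [in RHS]sigma_sg sgV -sigma_sg.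
Qed.

Lemma bruhatV : {mono (fun w : 'S_n => w^-1%g) : v w / bruhat v w}.
Proof.
apply: (@bruhat_word_symmetry _ rev); [exact: invgK | exact: size_rev | | exact: word_prod_rev].
by move=> s t; rewrite subseq_rev.
Qed.

Lemma lerV v w : ler v w -> ler v^-1%g w^-1%g.
Proof. by move=> /bruhatP vw; apply/bruhatP; rewrite bruhatV. Qed.

(** Conjugation by the longest element; it exchanges the two sides of s_k. *)
Definition flip w : 'S_n := (perm (@rev_ord_inj n) * w * perm (@rev_ord_inj n))%g.

Lemma rev_permK : (perm (@rev_ord_inj n) * perm (@rev_ord_inj n) = 1)%g.
Proof. by apply/permP => a; rewrite permM !permE rev_ordK. Qed.

Lemma flipK : involutive flip.
Proof.
by move=> w; rewrite /flip !mulgA rev_permK mul1g -mulgA rev_permK mulg1.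
Qed.

Lemma flipM v w : flip (v * w)%g = (flip v * flip w)%g.
Proof.
rewrite /flip !mulgA; congr (_ * _ * _)%g.
by rewrite -(mulgA (_ * v)%g) rev_permK mulg1.
Qed.

Lemma flip1 : flip 1%g = 1%g.
Proof. by rewrite /flip mulg1 rev_permK. Qed.

Lemma pn_flip w a : a < n -> pn (flip w) a = n.-1 - pn w (n.-1 - a).
Proof.
move=> an; have ran : n - a.+1 < n by lia.
rewrite -[a in LHS]/(nat_of_ord (Ordinal an)) pn_ord !permM !permE /=.
have -> : n.-1 - a = nat_of_ord (rev_ord (Ordinal an)) by rewrite /=; lia.
by rewrite pn_ord; lia.
Qed.

Lemma flip_sg i : i.+1 < n -> flip (sg n i) = sg n (n - i.+2).
Proof.
move=> iln; apply: eq_pn => a; have [an|na] := ltnP a n; last by rewrite !pn_out.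
rewrite pn_flip // !pn_sg //; last by lia.
by case: (swap_cases i (n.-1 - a)) => -[]; case: (swap_cases (n - i.+2) a) => -[]; lia.
Qed.

Lemma bruhat_flip : {mono flip : v w / bruhat v w}.
Proof.
apply: (@bruhat_word_symmetry _ (map (@rev_ord _))).
- exact: flipK.
- by move=> s; rewrite size_map.
- by move=> s t; apply: map_subseq.
move=> s; rewrite /word_prod big_map; elim: s => [|x s IHs]; first by rewrite !big_nil flip1.
rewrite !big_cons flipM IHs !sigma_sg flip_sg /=; last by have := ltn_ord x; lia.
by congr (sg n _ * _)%g; have := ltn_ord x; lia.
Qed.

Lemma ler_flip v w : ler v w -> ler (flip v) (flip w).
Proof. by move=> /bruhatP vw; apply/bruhatP; rewrite bruhat_flip. Qed.

Lemma order_isomorphic_imset d (L : porderType d) (phi : 'S_n -> 'S_n) (I : {set 'S_n}) :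
  involutive phi -> {mono phi : v w / bruhat v w} ->
  order_isomorphic L (@bruhat n) I -> order_isomorphic L (@bruhat n) (phi @: I).
Proof.
move=> phiK phim [f [finj fI fm]]; exists (phi \o f); split.
- by move=> a b /(inv_inj phiK)/finj.
- move=> x; split=> [/imsetP [y /fI [a <-] ->]|[a <-]]; first by exists a.
  by apply: imset_f; apply/fI; exists a.
- by move=> a b; rewrite fm /= phim.
Qed.

Lemma imset_interval (phi : 'S_n -> 'S_n) v w :
  involutive phi -> {mono phi : v w / bruhat v w} ->
  phi @: bruhat_interval v w = bruhat_interval (phi v) (phi w).
Proof.
move=> phiK phim; apply/setP => u; apply/imsetP/idP => [[x + ->]|].
  by rewrite !inE !phim.
by rewrite -{1}(phiK u) !inE !phim => h; exists (phi u); rewrite ?inE ?phiK.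
Qed.

End Symmetries.

(** * Doubling a boolean interval by a new letter *)

Section Extension.

Import Order.DefaultSetSubsetOrder.


Variable n : nat.
Implicit Types u v w : 'S_n.

Lemma le_set_subset (X : finType) (A B : {set X}) : (A <= B)%O = (A \subset B).
Proof. exact: Order.SetSubsetOrder.leEsubset. Qed.

Definition boolean_from (k : nat) w := is_boolean (@bruhat n) (bruhat_interval (sg n k) w).

Lemma sg_ascent k i : i != k -> k.+1 < n -> pn (sg n k) i < pn (sg n k) i.+1.
Proof.
move=> ik kn; rewrite !pn_sg //.
by case: (swap_cases k i) => -[]; case: (swap_cases k i.+1) => -[]; lia.
Qed.

(* No element of [s_k, v] has the left descent i, so that [s_k, s_i v] is the
   disjoint union of [s_k, v] and its translate by s_i. *)
Lemma boolean_extend (k i : nat) v : i != k -> i.+1 < n -> k.+1 < n -> ler (sg n k) v ->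
  ~ ler (sg n i * sg n k)%g v -> boolean_from k v -> boolean_from k (sg n i * v)%g.
Proof.
move=> ik iln kn kv nv [X [f [finj fI fm]]].
have fIn A : ler (sg n k) (f A) /\ ler (f A) v.
  have /fI : exists B, f B = f A by exists A.
  by rewrite inE => /andP[/bruhatP ? /bruhatP].
(* With a descent at i, lifting s_k would put s_i s_k below [u], hence below [v]. *)
have asc u : ler (sg n k) u -> ler u v -> pn u i < pn u i.+1.
  move=> ku uv; case: (asc_or_desc u i) => // ui.
  by case: nv; apply: ler_trans uv; apply: lift_up.
have fasc A : pn (f A) i < pn (f A) i.+1 by have [] := fIn A; apply: asc.
pose s (u : 'S_n) : 'S_n := (sg n i * u)%g.
have sK u : s (s u) = u by rewrite /s mulgA sgK mul1g.
have sdesc u : pn u i < pn u i.+1 -> pn (s u) i.+1 < pn (s u) i.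
  by rewrite /s !pn_sgM //= swapL swapR.
(* A subset of [option X] encodes an element of the doubled interval: [None] marks the translate by
   s_i, and the remaining members give the underlying element of [s_k, v]. *)
pose res (A : {set option X}) := [set x | Some x \in A].
pose g (A : {set option X}) : 'S_n := if None \in A then s (f (res A)) else f (res A).
have sub (A B : {set option X}) :
    (A \subset B) = ((None \in A) ==> (None \in B)) && (res A \subset res B).
  apply/subsetP/andP => [AB|[/implyP hN /subsetP hS] [x|]] //.
    by split; [apply/implyP; apply: AB | apply/subsetP => x; rewrite !inE; apply: AB].
  by have := hS x; rewrite !inE.
have gm (A B : {set option X}) : bruhat (g A) (g B) = (A \subset B).
  rewrite sub /g -(le_set_subset (res A)) fm.
  case: ifP => _; case: ifP => _ //=.
  - apply/bruhatP/bruhatP => h; last by apply: lift_both_asc.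
    by rewrite -(sK (f (res A))) -(sK (f (res B))); apply: lift_both; auto.
  - apply/negP => /bruhatP h; have := sdesc _ (fasc (res A)).
    have := asc (s (f (res A))); have [kf _] := fIn (res A); have [_ fv] := fIn (res B).
    move=> /(_ (ler_trans kf (ler_sgM iln (fasc _))) (ler_trans h fv)); lia.
  - apply/bruhatP/bruhatP => h; last by apply: ler_trans h _; apply: ler_sgM.
    by rewrite -(sK (f (res B))); apply: lift_down.
exists (option X : finType), g; split.
- move=> A B gAB; apply/eqP; rewrite eqEsubset -!gm gAB.
  by apply/andP; split; apply/bruhatP.
- move=> x; rewrite inE; split=> [/andP[/bruhatP kx /bruhatP xv]|[A <-]].
    have res_some (A : {set X}) : res (Some @: A) = A.
      by apply/setP => y; rewrite inE mem_imset //; apply: Some_inj.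
    have res_none (A : {set X}) : res (None |: Some @: A) = A.
      by apply/setP => y; rewrite !inE mem_imset //; apply: Some_inj.
    case: (asc_or_desc x i) => xi.
      have /fI [A fA] : x \in bruhat_interval (sg n k) v.
        rewrite inE; apply/andP; split; apply/bruhatP => //.
        by rewrite -(sK v); apply: lift_down.
      exists (Some @: A); rewrite /g res_some fA.
      by case: ifP => // /imsetP [].
    have /fI [A fA] : s x \in bruhat_interval (sg n k) v.
      rewrite inE; apply/andP; split; apply/bruhatP.
        by apply: lift_down => //; apply: sg_ascent.
      rewrite -(sK v); apply: lift_both => //.
      by apply: sdesc; apply: asc => //; apply: ler_refl.
    by exists (None |: Some @: A); rewrite /g res_none fA setU11 sK.
  have [kf fv] := fIn (res A); rewrite /g.
  have vsv := ler_sgM iln (asc _ kv (ler_refl v)).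
  case: ifP => _; apply/andP; split; apply/bruhatP => //.
  - by apply: ler_trans kf _; apply: ler_sgM.
  - by apply: lift_both_asc => //; apply: asc.
  - exact: ler_trans fv vsv.
- by move=> A B; rewrite gm le_set_subset.
Qed.

Lemma boolean_fromV k w : boolean_from k w -> boolean_from k w^-1%g.
Proof.
move=> [X wX]; exists X; rewrite -(sgV n k) -imset_interval; last exact: bruhatV.
  exact: order_isomorphic_imset (@invgK _) (@bruhatV n) wX.
exact: invgK.
Qed.

Lemma boolean_extend_right k i v : i != k -> i.+1 < n -> k.+1 < n -> ler (sg n k) v ->
  ~ ler (sg n k * sg n i)%g v -> boolean_from k v -> boolean_from k (v * sg n i)%g.
Proof.
move=> ik iln kn kv nv /boolean_fromV bv.
rewrite -(invgK (v * _)%g); apply: boolean_fromV; rewrite invMg sgV.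
apply: boolean_extend => //; first by have := lerV kv; rewrite sgV.
by move/lerV; rewrite invMg !sgV invgK.
Qed.

Lemma boolean_flip k w : k.+1 < n -> boolean_from k w -> boolean_from (n - k.+2) (flip w).
Proof.
move=> kn [X wX]; exists X; rewrite -flip_sg // -imset_interval; last exact: bruhat_flip.
  exact: order_isomorphic_imset (@flipK n) (@bruhat_flip n) wX.
exact: flipK.
Qed.

Lemma boolean_base k : boolean_from k (sg n k).
Proof.
exists void, (fun _ => sg n k); split.
- by move=> A B _; apply/setP; case.
- move=> x; rewrite inE; split=> [/andP[/bruhatP h1 /bruhatP h2]|[A <-]].
    by exists set0; apply: ler_anti.
  by rewrite andbb; apply/bruhatP; apply: ler_refl.
- move=> A B; rewrite le_set_subset.
  have -> : bruhat (sg n k) (sg n k) by apply/bruhatP; apply: ler_refl.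
  by apply/subsetP; case.
Qed.

End Extension.

(** * Rank criteria for the forbidden patterns, and good permutations *)

Section Avoidance.

Variable n : nat.
Implicit Types u v w : 'S_n.
Local Notation sg := (sg n).

Lemma rk1 i y : rk (pn (1%g : 'S_n)) i y = i - y.
Proof. by elim: i => [|i IHi]; rewrite ?rk0 // rkS IHi pn1; lia. Qed.

Lemma rk_ge w i y : i - y <= rk (pn w) i y.
Proof. by rewrite -rk1; apply: ler1. Qed.

(** The ranks of s_k exceed those of the identity only at (k + 1, k + 1), and there by one. *)
Lemma ler_sgP k w : k.+1 < n -> reflect (ler (sg k) w) (0 < rk (pn w) k.+1 k.+1).
Proof.
move=> kn; rewrite -(mulg1 (sg k)); apply: (iffP idP) => [h i y|/(_ k.+1 k.+1)].
  have := rk_ge w i y; have [->|ik] := eqVneq i k.+1; last by rewrite rk_sgM_neq ?rk1.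
  rewrite rk_sgM // pn1 rk1; have [->|] := eqVneq y k.+1; lia.
by rewrite rk_sgM // pn1; lia.
Qed.

Lemma rk_Msg_neq x w i y : x.+1 < n -> y != x.+1 ->
  rk (pn (w * sg x)%g) i y = rk (pn w) i y.
Proof.
move=> xn yx; apply: eq_bigr => a _; rewrite pnM pn_sg //.
by case: (swap_cases x (pn w a)) => -[]; lia.
Qed.

Lemma ler_Msg_desc x w : x.+1 < n -> pn w^-1%g x.+1 < pn w^-1%g x -> ler (w * sg x)%g w.
Proof.
move=> xn wx; have := lerV (ler_sgM_desc xn wx).
by rewrite invMg invgK sgV.
Qed.

Definition fix_above m w := forall a, m < a -> pn w a = a.

Lemma fix_above_le m w a : fix_above m w -> a <= m -> pn w a <= m.
Proof.
move=> wm am; rewrite leqNgt; apply/negP => h.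
by have /pn_inj := wm _ h; lia.
Qed.

Lemma fix_aboveV m w : fix_above m w -> fix_above m w^-1%g.
Proof. by move=> wm a /wm {1}<-; rewrite pnK. Qed.

Lemma fix_above_rk m w i y : fix_above m w -> m < y -> i <= y -> rk (pn w) i y = 0.
Proof.
move=> wm my iy; apply: rk_eq0 => a ai; have [am|ma] := leqP a m; last by rewrite wm //; lia.
by have := fix_above_le wm am; lia.
Qed.

Lemma fix_above_sgM m w : m.+1 < n -> fix_above m w -> fix_above m.+1 (sg m * w)%g.
Proof. by move=> mn wm a ma; rewrite pn_sgM //= swapD ?wm //; lia. Qed.

(** The transposition of j and j + 2, as a reduced word. *)
Definition trs j : 'S_n := (sg j * (sg j.+1 * sg j))%g.

Lemma pn_trs j a : j.+2 < n -> pn (trs j) a = swap j (swap j.+1 (swap j a)).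
Proof. by move=> jn; rewrite /trs !pnM !pn_sg //; apply: ltnW. Qed.

Lemma rk_trs j i y : j.+2 < n -> i != j.+1 -> i != j.+2 -> rk (pn (trs j)) i y = i - y.
Proof.
move=> jn ij ij'; have jn' := ltnW jn; rewrite /trs !rk_sgM_neq //.
by rewrite -(mulg1 (sg j)) rk_sgM_neq // rk1.
Qed.

Lemma rk_trs1 j y : j.+2 < n -> rk (pn (trs j)) j.+1 y = (j - y) + (y <= j.+2).
Proof.
move=> jn; have jn' := ltnW jn; rewrite /trs rk_sgM // rk_sgM_neq //; last by lia.
rewrite -{1}(mulg1 (sg j)) rk_sgM_neq //; last by lia.
by rewrite rk1 pnM !pn_sg // swapL swapD //; lia.
Qed.

Lemma rk_trs2 j y : j.+2 < n ->
  rk (pn (trs j)) j.+2 y = (j - y) + (y <= j.+1) + (y <= j.+2).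
Proof.
move=> jn; have jn' := ltnW jn; rewrite /trs rk_sgM_neq //; last by lia.
rewrite rk_sgM // -{1}(mulg1 (sg j)) rk_sgM // rk1 pn1 pn_sg //.
by rewrite swapD //; lia.
Qed.

(** The ranks of s_k t, for t = [trs j], differ from those of the identity only in rows k + 1, j + 1
    and j + 2; there the three hypotheses suffice, as ranks decrease in y. The value of t at k + 1
    is j + 2 if j = k + 1, and k + 1 otherwise. *)
Lemma ler_sg_trs k j w : k < j -> j.+2 < n ->
  0 < rk (pn w) k.+1 (pn (trs j) k.+1) -> 0 < rk (pn w) j.+1 j.+2 ->
  1 < rk (pn w) j.+2 j.+1 -> ler (sg k * trs j)%g w.
Proof.
move=> kj jn h1 h2 h3 i y; have kn : k.+1 < n by lia.
have := rk_ge w i y; have [->|ik] := eqVneq i k.+1.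
  rewrite rk_sgM // rk_trs //; [|lia|lia] => hy.
  have [yk|ky] := leqP y k; first by lia.
  case: (leqP y (pn (trs j) k.+1)) => [yt|]; last by lia.
  by have := rk_anti (pn w) k.+1 yt; lia.
rewrite rk_sgM_neq //; have [->|ij1] := eqVneq i j.+1.
  rewrite rk_trs1 // => hy; have [yk|ky] := leqP y j; first by lia.
  case: (leqP y j.+2) => [yt|]; last by lia.
  by have := rk_anti (pn w) j.+1 yt; lia.
have [->|ij2] := eqVneq i j.+2; last by rewrite rk_trs.
rewrite rk_trs2 // => hy; have [yk|ky] := leqP y j; first by lia.
have h4 : 0 < rk (pn w) j.+2 j.+2 by apply: leq_trans h2 (rk_mono _ _ (leqnSn _)).
by have [->|ne1] := eqVneq y j.+1; [|have [->|ne2] := eqVneq y j.+2]; lia.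
Qed.

Lemma card_rk w i y : i <= n -> rk (pn w) i y = #|[set a : 'I_n | a < i & y <= w a]|.
Proof.
move=> iln; rewrite /rk (big_ord_widen _ (fun a => (y <= pn w a) : nat) iln).
rewrite -sum1dep_card big_mkcondr; apply: eq_bigr => a _; rewrite pn_ord.
by case: (y <= _).
Qed.

(** Both sides are i minus the number of positions before i with value below i, and [w] maps these
    positions for [w] onto those for its inverse. *)
Lemma rkV w i : i <= n -> rk (pn w^-1%g) i i = rk (pn w) i i.
Proof.
move=> iln; rewrite !card_rk //.
suff e u : #|[set a : 'I_n | a < i & i <= u a]| + #|[set a : 'I_n | a < i & u a < i]| = i.
  have := e w; have := e w^-1%g.
  have -> : [set a : 'I_n | a < i & w^-1%g a < i] = w @: [set a : 'I_n | a < i & w a < i].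
    apply/setP => b; apply/idP/imsetP => [|[a + ->]]; rewrite !inE => /andP[h1 h2].
      by exists (w^-1%g b); rewrite ?inE ?permKV ?h1 ?h2.
    by rewrite permK h1 h2.
  rewrite card_imset => [e1 e2|]; last exact: perm_inj.
  by apply: (@addIn #|[set a : 'I_n | a < i & w a < i]|); rewrite e1 e2.
rewrite -cardsUI (_ : _ :&: _ = set0); last first.
  by apply/setP => a; rewrite !inE; lia.
rewrite cards0 addn0 (_ : _ :|: _ = [set a : 'I_n | a < i]); last first.
  by apply/setP => a; rewrite !inE; lia.
rewrite -[RHS]subn0 -(rk1 i 0) card_rk // ; congr #|pred_of_set _|.
by apply/setP => a; rewrite !inE andbT.
Qed.

(** Reversal turns the left side into the count of positions from i on with value below i, which by
    their values is the rank of the inverse. *)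
Lemma rk_flip w i : i <= n -> rk (pn (flip w)) (n - i) (n - i) = rk (pn w) i i.
Proof.
move=> iln; rewrite -(rkV w iln) !card_rk ?leq_subr //.
have winj : injective (fun a : 'I_n => w (rev_ord a)).
  by move=> a b /perm_inj/rev_ord_inj.
rewrite -(card_imset _ winj); congr #|pred_of_set _|.
apply/setP => b; apply/imsetP/idP => [[a + ->]|]; rewrite !inE /flip.
  by rewrite !permM permK !permE /=; have := ltn_ord a; have := ltn_ord (w (rev_ord a)); lia.
move=> /andP[h1 h2]; exists (rev_ord (w^-1%g b)); last by rewrite rev_ordK permKV.
have rE (c : 'I_n) : perm (@rev_ord_inj n) c = rev_ord c by rewrite permE.
rewrite inE !permM !rE rev_ordK permKV /=.
by have := ltn_ord b; have := ltn_ord (w^-1%g b); lia.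
Qed.

Lemma flipV w : flip w^-1%g = (flip w)^-1%g.
Proof. by apply/eqP; rewrite eq_sym eq_invg_mul -flipM mulgV flip1. Qed.

(** The pattern t s_k, the inverse of s_k t, is excluded through the inverse of [w], which makes the
    condition visibly invariant under inversion. *)
Definition avoids k w := forall j, k < j -> j.+2 < n ->
  ~ ler (sg k * trs j)%g w /\ ~ ler (sg k * trs j)%g w^-1%g.

(* The first condition excludes the pattern s_k s_{k+1} s_{k-1} s_k, the others
   s_k t and t s_k, where t = s_j s_{j+1} s_j, for j > k and for j + 1 < k. *)
Definition good k w :=
  [/\ rk (pn w) k.+1 k.+1 = 1, avoids k w & avoids (n - k.+2) (flip w)].

Lemma avoids_down k v w : ler v w -> avoids k w -> avoids k v.
Proof.
move=> vw ak j kj jn; have [a1 a2] := ak j kj jn.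
by split=> h; [apply: a1; apply: ler_trans vw | apply: a2; apply: ler_trans (lerV vw)].
Qed.

Lemma good_down k v w : ler v w -> 0 < rk (pn v) k.+1 k.+1 -> good k w -> good k v.
Proof.
move=> vw vk [wk a1 a2]; split; first by have := vw k.+1 k.+1; lia.
  exact: avoids_down a1.
exact: avoids_down (ler_flip vw) a2.
Qed.

Lemma avoidsV k w : avoids k w -> avoids k w^-1%g.
Proof. by move=> ak j kj jn; have [a1 a2] := ak j kj jn; rewrite invgK. Qed.

Lemma goodV k w : k.+1 < n -> good k w -> good k w^-1%g.
Proof.
move=> kn [wk a1 a2]; split; first by rewrite rkV //; lia.
  exact: avoidsV.
by rewrite flipV; apply: avoidsV.
Qed.

Lemma good_flip k w : k.+1 < n -> good k w -> good (n - k.+2) (flip w).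
Proof.
move=> kn [wk a1 a2]; split => //; last first.
  by rewrite flipK (_ : n - (n - k.+2).+2 = k) //; lia.
by rewrite (_ : (n - k.+2).+1 = n - k.+1) ?rk_flip //; lia.
Qed.

End Avoidance.

(** * Reducing a good permutation to s_k by interval extensions *)

Section Peeling.

Variable n : nat.
Implicit Types u v w : 'S_n.
Local Notation sg := (sg n).
Local Notation trs := (trs n).

(** At (m + 1, m + 1) the rank of s_m s_k is positive and that of [v] is zero. *)
Lemma not_ler_new k m v : k < m -> m.+1 < n -> fix_above m v -> ~ ler (sg m * sg k)%g v.
Proof.
move=> km mn vm /(_ m.+1 m.+1); rewrite (fix_above_rk vm) // rk_sgM // pn_sg; last by lia.
by rewrite swapD; lia.
Qed.

(** A left extension by the new letter s_{k+1}, then a right one by the same letter: the latter is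
    allowed because at (k + 1, k + 2) the rank of s_k s_{k+1} is positive, while s_{k+1} v has there
    the rank of v, which is zero. *)
Lemma boolean_conj1 k v : k.+2 < n -> fix_above k.+1 v -> ler (sg k) v ->
  boolean_from k v -> boolean_from k (sg k.+1 * v * sg k.+1)%g.
Proof.
move=> kn vk kv bv; have kn' := ltnW kn; have ne : k.+1 != k by lia.
apply: boolean_extend_right => //.
- by apply/ler_sgP; rewrite // rk_sgM_neq //; [apply/ler_sgP | lia].
- move=> /(_ k.+1 k.+2); rewrite (@rk_sgM_neq n k.+1) //; last by lia.
  by rewrite (fix_above_rk vk) // rk_sgM // pn_sg // swapL; lia.
- by apply: boolean_extend => //; apply: not_ler_new.
Qed.

(** Three extensions: s_{k+1} on the left, s_{k+2} on the right, s_{k+1} on the right. The ranks at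
    (k + 3, k + 3) and at (k + 1, k + 2) justify the last two. *)
Lemma boolean_conj2 k v : k.+3 < n -> fix_above k.+1 v -> ler (sg k) v ->
  boolean_from k v -> boolean_from k (sg k.+1 * v * sg k.+2 * sg k.+1)%g.
Proof.
move=> kn vk kv bv; have kn2 := ltnW kn; have kn1 := ltnW kn2.
have ne : k.+1 != k by lia. have ne' : k.+2 != k by lia.
have ksv : ler (sg k) (sg k.+1 * v)%g.
  by apply/ler_sgP; rewrite // rk_sgM_neq //; [apply/ler_sgP | lia].
apply: boolean_extend_right => //.
- apply/ler_sgP => //; rewrite rk_Msg_neq //; last by lia.
  exact/ler_sgP.
- move=> /(_ k.+1 k.+2); rewrite (@rk_Msg_neq n k.+2) //; last by lia.
  rewrite (@rk_sgM_neq n k.+1) //; last by lia.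
  by rewrite (fix_above_rk vk) // rk_sgM // pn_sg // swapL; lia.
apply: boolean_extend_right => //; last by apply: boolean_extend => //; apply: not_ler_new.
move=> /(_ k.+3 k.+3); rewrite (fix_above_rk (fix_above_sgM kn2 vk)) //.
rewrite (@rk_sgM_neq n k) //.
by rewrite -(mulg1 (sg k.+2)) rk_sgM // pn1; lia.
Qed.

(** One step of the descent from [w] to a smaller good permutation, along which boolean intervals
    can be carried back up. *)
Definition peels k w v :=
  [/\ good k v, ler v w, v <> w & boolean_from k v -> boolean_from k w].

(** Moving the value m + 1 from position m to position m + 1 makes that point fixed, so s_m is a new
    letter over the result. *)
Lemma peel_left k m w : k < m -> m.+1 < n -> good k w -> fix_above m.+1 w ->
  pn w m.+1 != m.+1 -> pn w m = m.+1 ->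
  peels k w (sg m * w)%g /\ fix_above m (sg m * w)%g.
Proof.
move=> km mn gw wm wmm wmE; set v := (sg m * w)%g.
have wlt : pn w m.+1 < pn w m.
  by rewrite wmE ltn_neqAle wmm (fix_above_le wm).
have vw : ler v w by apply: ler_sgM_desc.
have kn : k.+1 < n by lia.
have rkv : 0 < rk (pn v) k.+1 k.+1.
  by rewrite rk_sgM_neq //; [case: gw => -> | lia].
have vm : fix_above m v.
  move=> a; rewrite leq_eqVlt => /orP[/eqP <-|ma]; first by rewrite pn_sgM //= swapR.
  by rewrite pn_sgM //= swapD ?wm //; lia.
split=> //; split=> //; first exact: good_down gw.
- by move=> vwE; move: wmm; rewrite -vwE vm // eqxx.
move=> bv; rewrite -(mul1g w) -(sgK n m) -mulgA -/v.
apply: boolean_extend => //; [by lia | exact/ler_sgP | exact: not_ler_new].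
Qed.

Lemma peelsV k w v : k.+1 < n -> peels k w^-1%g v -> peels k w v^-1%g.
Proof.
move=> kn [gv vw vwE bv]; split.
- exact: goodV.
- by have := lerV vw; rewrite invgK.
- by move=> vwE'; apply: vwE; rewrite -vwE' invgK.
- by move=> /boolean_fromV; rewrite invgK => /bv/boolean_fromV; rewrite invgK.
Qed.

Lemma sgKl i w : (sg i * (sg i * w) = w)%g.
Proof. by rewrite mulgA sgK mul1g. Qed.

Lemma sgKr i w : (w * sg i * sg i = w)%g.
Proof. by rewrite -mulgA sgK mulg1. Qed.

Lemma inv_sgM i w : ((sg i * w)^-1 = w^-1 * sg i)%g.
Proof. by rewrite invMg sgV. Qed.

Lemma inv_Msg i w : ((w * sg i)^-1 = sg i * w^-1)%g.
Proof. by rewrite invMg sgV. Qed.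

Lemma peel_conj1 k w : k.+2 < n -> good k w -> fix_above k.+2 w ->
  pn w k.+2 <= k -> pn w^-1%g k.+2 <= k -> let v := (sg k.+1 * w * sg k.+1)%g in
  peels k w v /\ fix_above k.+1 v.
Proof.
move=> kn gw wk wp wq v; have kn' := ltnW kn; have [wkk _ _] := gw.
have w1 : pn w k.+1 = k.+1.
  have := rk_ge w k.+3 k.+1; rewrite !rkS in wkk *.
  have := fix_above_le wk (leqnSn k.+1); move=> le2 ge2.
  have ne : pn w k.+1 <> k.+2 by move=> e; move: wq; rewrite -e pnK; lia.
  by lia.
have w2 : pn w^-1%g k.+1 = k.+1 by rewrite -{1}w1 pnK.
have vw : ler v w.
  apply: ler_trans (ler_sgM_desc kn (_ : pn w k.+2 < pn w k.+1)); last by lia.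
  apply: ler_Msg_desc => //; rewrite ?(inv_Msg, inv_sgM) !pnM !pn_sg // w2 swapL swapD; lia.
have vm : fix_above k.+1 v.
  move=> a; rewrite leq_eqVlt => /orP[/eqP <-|ma].
    by rewrite !pnM !pn_sg // swapR w1 swapL.
  by rewrite !pnM !pn_sg // (@swapD k.+1 a) ?wk ?swapD //; lia.
have rkv : 0 < rk (pn v) k.+1 k.+1.
  by rewrite rk_Msg_neq // ?rk_sgM_neq // ?wkk //; lia.
split=> //; split=> //; first exact: good_down gw.
- by move=> vwE; move: wp; rewrite -vwE vm //; lia.
move=> bv; have -> : w = (sg k.+1 * v * sg k.+1)%g by rewrite /v !mulgA sgKr sgK mul1g.
by apply: boolean_conj1 => //; apply/(ler_sgP _ kn').
Qed.

(** Here [w] exchanges k + 1 and k + 3. Cancelling s_{k+1} in front, then s_{k+1} and s_{k+2}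
    behind, each at a descent, makes k + 2 and k + 3 fixed. *)
Lemma peel_conj2 k w : k.+3 < n -> good k w -> fix_above k.+3 w ->
  pn w k.+3 = k.+1 -> pn w k.+1 = k.+3 -> let v := (sg k.+1 * w * sg k.+1 * sg k.+2)%g in
  peels k w v /\ fix_above k.+1 v.
Proof.
move=> kn gw wk wp wq v; have kn2 := ltnW kn; have kn1 := ltnW kn2; have [wkk _ _] := gw.
have ip : pn w^-1%g k.+1 = k.+3 by rewrite -{1}wp pnK.
have iq : pn w^-1%g k.+3 = k.+1 by rewrite -{1}wq pnK.
have wk2 : pn w k.+2 < k.+3.
  have := fix_above_le wk (ltnW (ltnSn k.+2)).
  by rewrite leq_eqVlt => /orP[/eqP|//]; rewrite -wq => /pn_inj; lia.
have iw2 : pn w^-1%g k.+2 < k.+3.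
  have := fix_above_le (fix_aboveV wk) (ltnW (ltnSn k.+2)).
  by rewrite leq_eqVlt => /orP[/eqP|//]; rewrite -ip => /pn_inj; lia.
have vw : ler v w.
  apply: ler_trans (ler_sgM_desc kn2 (_ : pn w k.+2 < pn w k.+1)); last by lia.
  apply: (@ler_trans _ (sg k.+1 * w * sg k.+1)%g); apply: ler_Msg_desc => //.
    rewrite ?(inv_Msg, inv_sgM) !pnM !pn_sg // (@swapD k.+1 k.+3) //; try lia.
    by rewrite swapR iq ip swapL swapD //; lia.
  rewrite ?(inv_Msg, inv_sgM) !pnM !pn_sg // ip (@swapD k.+1 k.+3) //; try lia.
  by case: (swap_cases k.+1 (pn w^-1%g k.+2)) => -[]; lia.
have vm : fix_above k.+1 v.
  move=> a; rewrite leq_eqVlt => /orP[/eqP <-|].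
    by rewrite !pnM !pn_sg // swapR wq (@swapD k.+1) ?swapR //; lia.
  rewrite leq_eqVlt => /orP[/eqP <-|ma].
    by rewrite !pnM !pn_sg // (@swapD k.+1 k.+3) ?wp ?swapL //; lia.
  by rewrite !pnM !pn_sg // (@swapD k.+1 a) ?wk ?(@swapD k.+1 a) ?swapD //; lia.
have rkv : 0 < rk (pn v) k.+1 k.+1.
  by rewrite !rk_Msg_neq // ?rk_sgM_neq // ?wkk //; lia.
split=> //; split=> //; first exact: good_down gw.
- by move=> vwE; move: wp; rewrite -vwE vm //; lia.
move=> bv; have -> : w = (sg k.+1 * v * sg k.+2 * sg k.+1)%g.
  by rewrite /v !mulgA !sgKr sgK mul1g.
by apply: boolean_conj2 => //; apply/(ler_sgP _ kn1).
Qed.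

(** Let t be the transposition of m - 1 and m + 1. For m > k + 2 all conditions of [ler_sg_trs] hold
    with j = m - 1, so s_k t would be below [w]. For m = k + 2 the one at (k + 1, k + 3) has to
    fail, which forces the preimage of k + 3 to be k + 1; the inverse gives the image. *)
Lemma no_descent_cases k m w : k < m -> m.+1 < n -> good k w -> fix_above m.+1 w ->
  pn w m.+1 < m -> pn w^-1%g m.+1 < m ->
  m = k.+1 \/ [/\ m = k.+2, pn w k.+3 = k.+1 & pn w k.+1 = k.+3].
Proof.
move=> km mn gw wm p_lt q_lt; have [wkk a1 _] := gw; have wmV := fix_aboveV wm.
have rk2 u : pn u m.+1 < m -> 1 < rk (pn u) m.+1 m.
  by move=> um; have := rk_ge u m.+2 m; rewrite rkS; lia.
have rk_le (u : 'S_n) i : pn u^-1%g m.+1 < i -> 0 < rk (pn u) i m.+1.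
  by move=> ui; apply/rk_gt0; exists (pn u^-1%g m.+1); rewrite // pnKV.
have [mE|mk] := eqVneq m k.+1; [by left | right].
have [mE|mk'] := eqVneq m k.+2; last first.
  case: m km => [//|m] km in mn wm wmV p_lt q_lt rk2 rk_le mk mk' *.
  case: (a1 m); [lia | lia |].
  case; apply: ler_sg_trs => //; [by lia | | exact: rk_le | exact: rk2].
  by rewrite pn_trs // !swapD ?wkk //; lia.
subst m; have [n1 n2] := a1 k.+1 (ltnSn k) mn.
have bound u : ~ ler (sg k * trs k.+1)%g u -> pn u^-1%g k.+3 < k.+2 -> pn u k.+3 < k.+2 ->
    pn u^-1%g k.+3 = k.+1.
  move=> nu uq up; apply/eqP; rewrite eqn_leq -ltnS uq /= leqNgt; apply/negP => uqk.
  apply: nu; apply: ler_sg_trs => //; last exact: rk2.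
    by rewrite pn_trs // swapL swapL swapD; [apply: rk_le | lia | lia].
  by apply: rk_le; lia.
have q := bound w n1 q_lt p_lt.
have p : pn w k.+3 = k.+1 by rewrite -{1}(invgK w); apply: bound => //; rewrite invgK.
by split=> //; rewrite -{1}q pnKV.
Qed.

(** Let m + 1 be the last moved point. Its preimage is m, or its image is m (the same case for the
    inverse), or both are less than m and [no_descent_cases] leaves two shapes. *)
Lemma peel k w : k.+1 < n -> good k w -> ~ fix_above k.+1 w -> exists v, peels k w v.
Proof.
move=> kn gw nw.
have [m [km wm wmm]] : exists m, [/\ k < m, fix_above m.+1 w & pn w m.+1 != m.+1].
  pose P a := (k.+1 < a) && (pn w a != a).
  have exP : exists a, P a.
    apply: contrapT => nP; apply: nw => a ka; apply/eqP; rewrite -[_ == _]negbK.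
    by apply/negP => wa; apply: nP; exists a; rewrite /P ka.
  have ubP a : P a -> a <= n.
    move=> /andP[_ wa]; rewrite leqNgt; apply/negP => na.
    by move: wa; rewrite pn_out ?eqxx //; lia.
  have [[//|m] /andP[km wm] maxm] := ex_maxnP exP ubP.
  exists m; split=> // a ma; apply/eqP; rewrite -[_ == _]negbK; apply/negP => wa.
  by have := maxm a; rewrite /P wa; lia.
have mn : m.+1 < n by rewrite ltnNge; apply/negP => nm; move: wmm; rewrite pn_out ?eqxx.
have wmV := fix_aboveV wm.
have wmmV : pn w^-1%g m.+1 != m.+1.
  by apply/eqP => e; move: wmm; rewrite -{1}e pnKV eqxx.
have p_le := fix_above_le wm (leqnn _); have q_le := fix_above_le wmV (leqnn _).
have [qm|qm] := eqVneq (pn w^-1%g m.+1) m.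
  have wmE : pn w m = m.+1 by rewrite -{1}qm pnKV.
  by have [peelsw _] := peel_left km mn gw wm wmm wmE; exists (sg m * w)%g.
have [pm|pm] := eqVneq (pn w m.+1) m.
  have wmE : pn w^-1%g m = m.+1 by rewrite -{1}pm pnK.
  have [peelsw _] := peel_left km mn (goodV kn gw) wmV wmmV wmE.
  by exists (sg m * w^-1)^-1%g; apply: peelsV.
have p_lt : pn w m.+1 < m by lia.
have q_lt : pn w^-1%g m.+1 < m by lia.
have [mE|[mE p q]] := no_descent_cases km mn gw wm p_lt q_lt; subst m.
  have [//|//|peelsw _] := peel_conj1 mn gw wm.
  by exists (sg k.+1 * w * sg k.+1)%g.
have [peelsw _] := peel_conj2 mn gw wm p q.
by exists (sg k.+1 * w * sg k.+1 * sg k.+2)%g.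
Qed.

(** Only k and k + 1 can move, and the rank at (k + 1, k + 1) excludes the identity. *)
Lemma good_supportE k w : k.+1 < n -> good k w -> fix_above k.+1 w ->
  fix_above (n - k.+2).+1 (flip w) -> w = sg k.
Proof.
move=> kn [wkk _ _] wk fwk.
have low a : a < k -> pn w a = a.
  move=> ak; have an : n.-1 - a < n by lia.
  have := fwk (n.-1 - a); rewrite pn_flip //.
  have -> : n.-1 - (n.-1 - a) = a by lia.
  have wa : pn w a < n by apply: pn_lt; lia.
  by lia.
have wk1 : pn w k = k.+1.
  move: wkk; rewrite rkS rk_eq0; last by move=> a ak; rewrite low //; lia.
  by have := fix_above_le wk (leqnSn k); lia.
apply: eq_pn => a; rewrite pn_sg //.
case: (swap_cases k a) => [[-> ->]//|[-> ->]|[ak ak1 ->]].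
  have := fix_above_le wk (leqnn _); rewrite leq_eqVlt => /orP[/eqP e|].
    by have /pn_inj := etrans e (esym wk1); lia.
  rewrite ltnS leq_eqVlt => /orP[/eqP //|h].
  by have /pn_inj := low _ h; lia.
by have [?|?] := ltnP a k; [apply: low | apply: wk; lia].
Qed.

(** The size of the lower ideal is the induction measure for peeling; unlike the length, it needs no
    comparison of words. *)
Lemma bruhat_card_lt v w : ler v w -> v <> w ->
  #|[set u | bruhat u v]| < #|[set u | bruhat u w]|.
Proof.
move=> vw vwE; apply: proper_card; apply/properP; split.
  apply/subsetP => u; rewrite !inE => /bruhatP uv; apply/bruhatP.
  exact: ler_trans vw.
exists w; rewrite !inE; first by apply/bruhatP; apply: ler_refl.
by apply/bruhatP => wv; apply: vwE; apply: ler_anti.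
Qed.

(** Peel while a point above k + 1 moves; then flip and peel the points below k; what is left is
    s_k. *)
Lemma good_boolean k w : k.+1 < n -> good k w -> boolean_from k w.
Proof.
have [N] := ubnP #|[set u | bruhat u w]|; elim: N w => // N IHN w wN kn gw.
have step v : ler v w -> v <> w -> good k v -> boolean_from k v.
  move=> vw vwE gv; apply: IHN => //.
  by rewrite -ltnS; apply: leq_trans wN; rewrite ltnS; apply: bruhat_card_lt.
have [wk|nwk] := pselect (fix_above k.+1 w); last first.
  by have [v [gv vw vwE bv]] := peel kn gw nwk; auto.
have [fwk|nfwk] := pselect (fix_above (n - k.+2).+1 (flip w)).
  by rewrite (good_supportE kn gw) //; apply: boolean_base.
have kn' : (n - k.+2).+1 < n by lia.
have [v [gv vw vwE bv]] := peel kn' (good_flip kn gw) nfwk.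
have kE : n - (n - k.+2).+2 = k by lia.
have := boolean_flip kn'; rewrite kE => bflip.
rewrite -(flipK w); apply: bflip; apply: bv.
rewrite -(flipK v); apply: boolean_flip => //; apply: step.
- by have := ler_flip vw; rewrite flipK.
- by move=> vwE'; apply: vwE; rewrite -vwE' flipK.
- by have := good_flip kn' gv; rewrite kE.
Qed.

End Peeling.

(** * Length along the Bruhat order, and explicit reduced words *)

Section Words.

Variable n : nat.
Implicit Types u v w : 'S_n.
Implicit Types s t : seq nat.
Local Notation sg := (sg n).

Lemma ler_ell v w : ler v w -> ell v <= ell w ?= iff (v == w).
Proof.
move=> /exists_subword [s [t [/reducedP [sv se] /reducedP [tw te] st]]].
rewrite -se -te; have [le eq] := size_subseq_leqif st; split=> //.
rewrite eq; apply/eqP/eqP => [e|e]; first by rewrite -sv e tw.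
by apply/eqP; rewrite -eq se te e.
Qed.

Definition word s : 'S_n := foldr (fun i u => (sg i * u)%g) 1%g s.

(** A certificate of reducedness that can be checked by computation: each letter is put in front at
    an ascent. *)
Fixpoint ascending s : Prop :=
  if s is i :: s' then
    [/\ i.+1 < n, pn (word s') i < pn (word s') i.+1 & ascending s']
  else True.

Lemma ell_ascending s : ascending s -> ell (word s) = size s.
Proof.
by elim: s => [|i s IHs] /=; [rewrite ell1 | case=> iln si /IHs <-; rewrite ell_sgM].
Qed.

Lemma ler_ascending s t : ascending t -> subseq s t -> ler (word s) (word t).
Proof.
elim: t s => [|i t IHt] [|j s] //=; try by move=> *; apply: ler1.
move=> [iln ti asct]; case: eqP => [->|_] st.
  by apply: lift_both_asc => //; apply: IHt.
exact: ler_trans (IHt (j :: s) asct st) (ler_sgM iln ti).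
Qed.

End Words.

(** Splits on innermost occurrences of [swap], discarding contradictory cases, until none is
    left. *)
Ltac eval_swap := repeat match goal with |- context [swap ?i ?a] =>
  lazymatch a with context [swap _ _] => fail | _ =>
    case: (swap_cases i a) => [[? ->]|[? ->]|[? ? ->]]; try (exfalso; lia)
  end end.

Ltac solve_ascending := rewrite /=; do ![split]; try lia;
  rewrite ?pnM ?pn_sg ?pn1; try lia; eval_swap; lia.

Ltac solve_subseq := rewrite /=; repeat match goal with |- context [@eq_op _ ?a ?b] =>
  first [rewrite (eqxx a) /= | have -> : (a == b :> nat) = false by lia] end; rewrite /= ?eqxx //.

(** * Forbidden patterns in modular intervals, and the equivalence of the three classes *)

Section Modular.

Import Order.LTheory.

Variable n : nat.
Implicit Types u v w : 'S_n.
Local Notation sg := (sg n).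
Local Notation word := (@word n).

Definition interval_iso d (L : latticeType d) k w :=
  order_isomorphic L (@bruhat n) (bruhat_interval (sg k) w).

(** Names lattice elements: a reduced subword of [t] that contains the letter k is a point of the
    interval. *)
Lemma interval_iso_word d (L : latticeType d) k w (f : L -> 'S_n) s t :
    (forall x, x \in bruhat_interval (sg k) w <-> exists a, f a = x) ->
    ler (word t) w -> ascending n t -> ascending n s -> subseq s t -> subseq [:: k] s ->
  exists A, f A = word s.
Proof.
move=> fI tw asct ascs st ks; apply/fI; rewrite inE; apply/andP; split; apply/bruhatP.
  by rewrite -(mulg1 (sg k)) -[(_ * _)%g]/(word [:: k]); apply: ler_ascending.
exact: ler_trans (ler_ascending asct st) tw.
Qed.

(** The atoms s_k s_j and s_k s_{j+1} have the common upper bounds s_k s_j s_{j+1} and s_k s_{j+1}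
    s_j. Their join would have length at most 2 and equal both atoms, or length 3 and equal both
    bounds. *)
Lemma not_lattice d (L : latticeType d) k j w : k < j -> j.+2 < n ->
  interval_iso L k w -> ~ ler (sg k * trs n j)%g w.
Proof.
move=> kj jn [f [finj fI fm]].
have -> : (sg k * trs n j)%g = word [:: k; j; j.+1; j] by rewrite /word /trs /= mulg1.
have asct : ascending n [:: k; j; j.+1; j] by solve_ascending.
move=> xw; have elt := interval_iso_word fI xw asct.
have asca : ascending n [:: k; j] by solve_ascending.
have ascb : ascending n [:: k; j.+1] by solve_ascending.
have ascc : ascending n [:: k; j; j.+1] by solve_ascending.
have ascd : ascending n [:: k; j.+1; j] by solve_ascending.
have [||A fA] := elt _ asca; try solve_subseq.
have [||B fB] := elt _ ascb; try solve_subseq.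
have [||C fC] := elt _ ascc; try solve_subseq.
have [||D fD] := elt _ ascd; try solve_subseq.
have le E F : ler (f E) (f F) -> (E <= F)%O by rewrite fm => /bruhatP.
have ge E F : (E <= F)%O -> ler (f E) (f F) by rewrite fm => /bruhatP.
have AC : (A <= C)%O.
  by apply: le; rewrite fA fC; apply: ler_ascending; rewrite //; solve_subseq.
have BC : (B <= C)%O.
  by apply: le; rewrite fB fC; apply: ler_ascending; rewrite //; solve_subseq.
have AD : (A <= D)%O.
  by apply: le; rewrite fA fD; apply: ler_ascending; rewrite //; solve_subseq.
have BD : (B <= D)%O.
  by apply: le; rewrite fB fD; apply: ler_ascending; rewrite //; solve_subseq.
pose Z := (A `|` B)%O.
have ZC : (Z <= C)%O by rewrite leUx AC BC.
have ZD : (Z <= D)%O by rewrite leUx AD BD.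
have AB : A <> B.
  move/(congr1 (fun E => pn (f E) j.+2)); rewrite fA fB /= !pnM !pn_sg ?pn1; try lia.
  by eval_swap; lia.
have CD : C <> D.
  move/(congr1 (fun E => pn (f E) j.+2)); rewrite fC fD /= !pnM !pn_sg ?pn1; try lia.
  by eval_swap; lia.
have [le1 eq1] := ler_ell (ge A Z (leUl A B)).
have [le2 eq2] := ler_ell (ge B Z (leUr B A)).
have [le3 eq3] := ler_ell (ge _ _ ZC).
have [le4 eq4] := ler_ell (ge _ _ ZD).
have := ell_ascending asca; have := ell_ascending ascb.
have := ell_ascending ascc; have := ell_ascending ascd.
rewrite -fA -fB -fC -fD /= => ld lc lb la.
have [lz|lz] := leqP (ell (f Z)) 2.
  apply: AB; apply: finj; have /eqP -> : f A == f Z by rewrite -eq1; lia.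
  by apply/eqP; rewrite eq_sym -eq2; lia.
apply: CD; apply: finj; have /eqP <- : f Z == f C by rewrite -eq3; lia.
by apply/eqP; rewrite -eq4; lia.
Qed.

Lemma rk_col w i y : rk (pn w) i y <= rk (pn w) i y.+1 + (pn w^-1%g y < i).
Proof.
elim: i => [|i IHi]; first by rewrite !rk0.
rewrite !rkS; have [e|] := eqVneq (pn w i) y; last by lia.
by have := pnK w i; rewrite e; lia.
Qed.

Lemma rk_le_size f i y : rk f i y <= i.
Proof. by elim: i => [|i IHi]; rewrite ?rk0 // rkS; lia. Qed.

(** From (h + 2, h + 2), one step in row or column lowers the rank by at most one; this gives every
    entry in which the word exceeds the identity. *)
Lemma ler_square h w : h.+3 < n -> 1 < rk (pn w) h.+2 h.+2 ->
  ler (word [:: h.+1; h.+2; h; h.+1]) w.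
Proof.
move=> hn wh i y; have hn2 := ltnW hn; have hn1 := ltnW hn2.
have := rk_ge w i y; rewrite /word /= mulg1.
set q3 := (sg h * sg h.+1)%g; set q2 := (sg h.+2 * q3)%g.
have q3E i' y' : i' != h.+1 -> i' != h.+2 -> rk (pn q3) i' y' = i' - y'.
  by move=> h1 h2; rewrite rk_sgM_neq // -(mulg1 (sg _)) rk_sgM_neq // rk1.
have q3E1 y' : rk (pn q3) h.+1 y' = (h - y') + (y' <= h.+2).
  rewrite rk_sgM // -{1}(mulg1 (sg h.+1)) rk_sgM_neq ?rk1 //; last by lia.
  by rewrite pn_sg // swapL.
have q3E2 y' : rk (pn q3) h.+2 y' = (h.+1 - y') + (y' <= h.+2).
  by rewrite rk_sgM_neq //; [rewrite -(mulg1 (sg _)) rk_sgM // rk1 pn1 | lia].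
have q2v : pn q2 h.+2 = h.+3 by rewrite /q2 /q3 !pnM !pn_sg //; eval_swap; lia.
have q3v : pn q3 h.+3 = h.+3 by rewrite /q3 !pnM !pn_sg //; eval_swap; lia.
have r1 : 0 < rk (pn w) h.+1 h.+2 by move: wh; rewrite rkS; lia.
have r2 : 0 < rk (pn w) h.+2 h.+3 by have := rk_col w h.+2 h.+2; lia.
have r3 : rk (pn w) h.+2 h.+3 <= rk (pn w) h.+3 h.+3 by rewrite [leqRHS]rkS; lia.
have r4 : rk (pn w) h.+2 h.+2 <= rk (pn w) h.+3 h.+2 by rewrite [leqRHS]rkS; lia.
have [->|i2] := eqVneq i h.+2.
  rewrite rk_sgM // rk_sgM_neq //; last by lia.
  rewrite q3E1 q2v => ge.
  have [yh|hy] := leqP y h.+1; first by have := rk_anti (pn w) h.+2 (leqW yh); lia.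
  have [->|y2] := eqVneq y h.+2; first by lia.
  have [->|y3] := eqVneq y h.+3; lia.
rewrite rk_sgM_neq //; have [->|i3] := eqVneq i h.+3.
  rewrite rk_sgM // q3E2 q3v => ge.
  have [->|y2] := eqVneq y h.+2; first by lia.
  have [->|y3] := eqVneq y h.+3; lia.
rewrite rk_sgM_neq //; have [->|i1] := eqVneq i h.+1; last by rewrite q3E.
rewrite q3E1 => ge; have [yh|hy] := leqP y h; first by lia.
have [y2|] := leqP y h.+2; last by lia.
by have := rk_anti (pn w) h.+1 y2; lia.
Qed.

(** If the rank is at least 2, the interval contains A = s_k s_{k+1}, B = s_{k-1} s_k and C = s_k
    s_{k+1} s_k. Here A is below C, B and C meet in s_k, and C is below the join of A and B, so the
    modular law would give A = C. *)
Lemma modular_rk d (L : latticeType d) k w : k.+1 < n ->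
  modular_law L -> interval_iso L k w -> rk (pn w) k.+1 k.+1 <= 1.
Proof.
move=> kn mod [f [finj fI fm]]; rewrite leqNgt; apply/negP => wk.
case: k kn wk fI => [|h] hn wh fI; first by have := rk_le_size (pn w) 1 1; lia.
have hn3 : h.+3 < n.
  rewrite ltn_neqAle hn andbT; apply/eqP => nE.
  have r0 : rk (pn w) h.+2 h.+3 = 0.
    by apply: rk_eq0 => a ah; have := @pn_lt _ w a; lia.
  by have := rk_col w h.+2 h.+2; lia.
have xw := ler_square hn3 wh.
have asct : ascending n [:: h.+1; h.+2; h; h.+1] by solve_ascending.
have asca : ascending n [:: h.+1; h.+2] by solve_ascending.
have ascb : ascending n [:: h; h.+1] by solve_ascending.
have ascc : ascending n [:: h.+1; h.+2; h.+1] by solve_ascending.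
have ascs : ascending n [:: h.+1] by solve_ascending.
have elt := interval_iso_word fI xw asct.
have [||Q fQ] := elt _ asct; try solve_subseq.
have [||A fA] := elt _ asca; try solve_subseq.
have [||B fB] := elt _ ascb; try solve_subseq.
have [||C fC] := elt _ ascc; try solve_subseq.
have [||S fS] := elt _ ascs; try solve_subseq.
have le E F : ler (f E) (f F) -> (E <= F)%O by rewrite fm => /bruhatP.
have ge E F : (E <= F)%O -> ler (f E) (f F) by rewrite fm => /bruhatP.
have min E : (S <= E)%O.
  apply: le; have /fI : exists F, f F = f E by exists E.
  by rewrite inE fS /= mulg1 => /andP[/bruhatP].
have AC : (A <= C)%O.
  by apply: le; rewrite fA fC; apply: ler_ascending; rewrite //; solve_subseq.
have AQ : (A <= Q)%O.
  by apply: le; rewrite fA fQ; apply: ler_ascending; rewrite //; solve_subseq.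
have BQ : (B <= Q)%O.
  by apply: le; rewrite fB fQ; apply: ler_ascending; rewrite //; solve_subseq.
have rkB : 0 < rk (pn (f B)) h.+1 h.+2.
  apply/rk_gt0; exists h => //; rewrite fB /= !pnM !pn_sg ?pn1; try lia.
  by eval_swap; lia.
have rkC : rk (pn (f C)) h.+1 h.+2 = 0.
  apply: rk_eq0 => a ah; rewrite fC /= !pnM !pn_sg ?pn1; try lia.
  by eval_swap; lia.
have rkQ : rk (pn (f Q)) h.+1 h.+3 = 0.
  apply: rk_eq0 => a ah; rewrite fQ /= !pnM !pn_sg ?pn1; try lia.
  by eval_swap; lia.
have rkA : 0 < rk (pn (f A)) h.+2 h.+3.
  apply/rk_gt0; exists h.+1 => //; rewrite fA /= !pnM !pn_sg ?pn1; try lia.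
  by eval_swap; lia.
(* B is not below C, by the rank at (h + 1, h + 2), so the meet is strictly below B, which has
   length 2. *)
have BCS : (B `&` C)%O = S.
  have BCB := ge _ _ (leIl B C).
  have BCC := ge _ _ (leIr C B).
  have [l1 e1] := ler_ell BCB; have [l2 e2] := ler_ell (ge _ _ (min (B `&` C)%O)).
  have := ell_ascending ascb; have := ell_ascending ascs; rewrite -fB -fS /= => ls lb.
  have ne : f (B `&` C)%O != f B.
    by apply/eqP => e; have := BCC h.+1 h.+2; rewrite e rkC; lia.
  apply: finj; apply/eqP; rewrite eq_sym -e2.
  by move: ne; rewrite -e1; lia.
(* The bound Q makes the rank of the join zero at (h + 1, h + 3), so A forces its value at h + 1 to
   be at least h + 3; with B this gives rank at least 2 at (h + 2, h + 2), enough to be above C. *)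
have CZ : (C <= A `|` B)%O.
  have AZ := ge _ _ (leUl A B).
  have BZ := ge _ _ (leUr B A).
  have ZQ : ler (f (A `|` B)%O) (f Q) by apply: ge; rewrite leUx AQ BQ.
  apply: le; move: AZ BZ ZQ; set z := f (A `|` B)%O => AZ BZ ZQ; rewrite fC.
  have z1 := ZQ h.+1 h.+3; have z2 := AZ h.+2 h.+3; have z3 := BZ h.+1 h.+2.
  have z4 : rk (pn z) h.+2 h.+2 <= rk (pn z) h.+3 h.+2 by rewrite [leqRHS]rkS; lia.
  have zh : h.+3 <= pn z h.+1 by have := rkS (pn z) h.+1 h.+3; lia.
  have z5 : rk (pn z) h.+2 h.+2 = (rk (pn z) h.+1 h.+2).+1 by rewrite rkS; lia.
  move=> i y; rewrite /= mulg1 -/(trs n h.+1); have := rk_ge z i y.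
  have [->|i2] := eqVneq i h.+2.
    rewrite rk_trs1 // => ge'; have [yh|hy] := leqP y h.+1; first by lia.
    have [y3|] := leqP y h.+3; last by lia.
    by have := rk_anti (pn z) h.+2 y3; lia.
  have [->|i3] := eqVneq i h.+3; last by rewrite rk_trs.
  rewrite rk_trs2 // => ge'; have [yh|hy] := leqP y h.+1; first by lia.
  have z6 : rk (pn z) h.+2 h.+3 <= rk (pn z) h.+3 h.+3 by rewrite [leqRHS]rkS; lia.
  have [->|y2] := eqVneq y h.+2; first by lia.
  by have [->|y3] := eqVneq y h.+3; lia.
have := mod A B C AC; rewrite BCS.
have -> : (A `|` S)%O = A by apply: join_l.
have -> : ((A `|` B) `&` C)%O = C by apply: meet_r.
move=> ACE; have := ell_ascending asca; have := ell_ascending ascc.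
by rewrite -fA -fC ACE /= => -> .
Qed.

(** Inversion and [flip] preserve the lattice, so excluding s_k t for j > k also excludes t s_k and
    the patterns on the other side. *)
Lemma modular_good d (L : latticeType d) k w : k.+1 < n -> ler (sg k) w ->
  modular_law L -> interval_iso L k w -> good k w.
Proof.
move=> kn kw mod iso.
have isoV k' u : interval_iso L k' u -> interval_iso L k' u^-1%g.
  rewrite /interval_iso => u_iso; rewrite -[X in bruhat_interval X _](sgV n k').
  rewrite -imset_interval; [|exact: invgK|exact: bruhatV].
  exact: order_isomorphic_imset (@invgK _) (@bruhatV n) u_iso.
have av k' u : interval_iso L k' u -> avoids k' u.
  by move=> u_iso j kj jn; split; apply: (@not_lattice _ L) => //; apply: isoV.
split; [|exact: av|].
  by apply/eqP; rewrite eqn_leq (modular_rk kn mod iso); apply/ler_sgP.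
apply: av; rewrite /interval_iso -flip_sg // -imset_interval; [|exact: flipK|exact: bruhat_flip].
exact: order_isomorphic_imset (@flipK n) (@bruhat_flip n) iso.
Qed.

Import Order.DefaultSetSubsetOrder.

Lemma boolean_distributive (T : finType) (le : rel T) (I : {set T}) :
  is_boolean le I -> is_distributive_lattice le I.
Proof. by move=> [X iso]; eexists; exists {set X}. Qed.

Lemma distributive_modular (T : finType) (le : rel T) (I : {set T}) :
  is_distributive_lattice le I -> is_modular_lattice le I.
Proof.
move=> [d [L iso]]; exists d, L; split=> // x y z xz.
by rewrite joinIr (join_r xz).
Qed.

(** A cycle: boolean, distributive, modular, good, boolean. *)
Lemma boolean_modular_good k w : k.+1 < n -> ler (sg k) w ->
  [/\ boolean_from k w <-> good k w,
      boolean_from k w <-> is_modular_lattice (@bruhat n) (bruhat_interval (sg k) w)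
    & boolean_from k w <-> is_distributive_lattice (@bruhat n) (bruhat_interval (sg k) w)].
Proof.
move=> kn kw.
have mg : is_modular_lattice (@bruhat n) (bruhat_interval (sg k) w) -> good k w.
  by move=> [d [L [mod iso]]]; apply: modular_good iso.
have gb : good k w -> is_boolean (@bruhat n) (bruhat_interval (sg k) w).
  exact: good_boolean.
have bd := @boolean_distributive _ (@bruhat n) (bruhat_interval (sg k) w).
have dm := @distributive_modular _ (@bruhat n) (bruhat_interval (sg k) w).
by rewrite /boolean_from; split; split; auto.
Qed.

End Modular.

(** * Restoring peeled letters keeps a permutation good *)

Section GoodProducts.

Variable n : nat.
Implicit Types u v w x : 'S_n.
Local Notation sg := (sg n).
Local Notation trs := (trs n).

Lemma avoidsE k w : avoids k w <-> forall j, k < j -> j.+2 < n ->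
  ~ ler (sg k * trs j)%g w /\ ~ ler (trs j * sg k)%g w.
Proof.
have xV j : ((sg k * trs j)^-1 = trs j * sg k)%g.
  by rewrite invMg sgV /trs !invMg !sgV !mulgA.
split=> ak j kj jn; have [a1 a2] := ak j kj jn; split=> // h; apply: a2.
  by rewrite -(invgK (_ * _)%g) xV; apply: lerV.
by rewrite -xV -(invgK w); apply: lerV.
Qed.

Lemma fix_above_pattern k j : k < j -> j.+2 < n ->
  fix_above j.+2 (sg k * trs j)%g /\ fix_above j.+2 (trs j * sg k)%g.
Proof.
move=> kj jn; have kn : k.+1 < n by lia.
by split=> a ja; rewrite pnM ?pn_trs ?pn_sg ?pn_trs //; eval_swap; lia.
Qed.

Lemma rk_pattern k j : k < j -> j.+2 < n ->
  0 < rk (pn (sg k * trs j)%g) j.+1 j.+2 /\ 0 < rk (pn (trs j * sg k)%g) j.+1 j.+2.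
Proof.
move=> kj jn; have kn : k.+1 < n by lia.
split; first by rewrite rk_sgM_neq ?rk_trs1; lia.
by rewrite rk_Msg_neq ?rk_trs1; lia.
Qed.

(** Every pattern with j > k has positive rank at (j + 1, j + 2), where [w] has rank zero. *)
Lemma avoids_fix_above k w : fix_above k.+2 w -> avoids k w.
Proof.
move=> wk; apply/avoidsE => j kj jn; have [r1 r2] := rk_pattern kj jn.
by split=> /(_ j.+1 j.+2); rewrite (fix_above_rk wk); lia.
Qed.

(** If j + 2 is at most m, a pattern has an ascent at m and lifting moves it below [v]. Otherwise
    s_m v has rank zero at (j + 1, j + 2). *)
Lemma avoids_sgM_new k m v : k < m -> m.+1 < n -> fix_above m v -> avoids k v ->
  avoids k (sg m * v)%g.
Proof.
move=> km mn vm /avoidsE av; apply/avoidsE => j kj jn; have [n1 n2] := av j kj jn.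
suff step x : fix_above j.+2 x -> 0 < rk (pn x) j.+1 j.+2 -> ~ ler x v ->
    ~ ler x (sg m * v)%g.
  have [f1 f2] := fix_above_pattern kj jn; have [r1 r2] := rk_pattern kj jn.
  by split; apply: step.
move=> xj rx nx xmv; have [jm|mj] := leqP j.+2 m.
  apply: nx; rewrite -(sgKl m v); apply: lift_down => //.
  have xm : fix_above m x by move=> a ma; apply: xj; lia.
  by rewrite (xm m.+1) // ltnS; apply: fix_above_le xm _.
have := xmv j.+1 j.+2; have [jE|jE] := eqVneq j.+1 m.
  by rewrite rk_sgM_neq // ?(fix_above_rk vm); lia.
by rewrite (fix_above_rk (fix_above_sgM mn vm)); lia.
Qed.

(** For m < k both patterns have an ascent at m, so lifting would put them below [v]. *)
Lemma avoids_sgM_low k m v : m < k -> k.+1 < n -> avoids k v -> avoids k (sg m * v)%g.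
Proof.
move=> mk kn /avoidsE av; apply/avoidsE => j kj jn; have [n1 n2] := av j kj jn.
have mn : m.+1 < n by lia.
suff asc x : x = (sg k * trs j)%g \/ x = (trs j * sg k)%g -> pn x m < pn x m.+1.
  by split=> h; [apply: n1|apply: n2]; rewrite -(sgKl m v); apply: lift_down => //;
    apply: asc; auto.
by have jn' := ltnW jn; case=> ->; rewrite /trs !pnM !pn_sg //; eval_swap; lia.
Qed.

Lemma avoids_Msg_low k m v : m < k -> k.+1 < n -> avoids k v -> avoids k (v * sg m)%g.
Proof.
move=> mk kn /avoidsV av; rewrite -(invgK (_ * _)%g) inv_Msg; apply: avoidsV.
exact: avoids_sgM_low.
Qed.

Lemma good_sg k : k.+1 < n -> good k (sg k).
Proof.
move=> kn; have fsg i : i.+1 < n -> fix_above i.+2 (sg i).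
  by move=> iln a ia; rewrite pn_sg // swapD; lia.
split.
- by rewrite -(mulg1 (sg k)) rk_sgM // rk1 pn1; lia.
- by apply: avoids_fix_above; apply: fsg.
- by rewrite flip_sg //; apply: avoids_fix_above; apply: fsg; lia.
Qed.

Lemma good_sgM_new k m v : k < m -> m.+1 < n -> fix_above m v -> good k v ->
  good k (sg m * v)%g.
Proof.
move=> km mn vm [vk a1 a2]; split.
- by rewrite rk_sgM_neq //; lia.
- exact: avoids_sgM_new.
- by rewrite flipM flip_sg //; apply: avoids_sgM_low => //; lia.
Qed.

Lemma good_conj1 k v : k.+2 < n -> fix_above k.+1 v -> good k v ->
  fix_above k.+2 (sg k.+1 * v * sg k.+1)%g /\ good k (sg k.+1 * v * sg k.+1)%g.
Proof.
move=> kn vk [rv a1 a2].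
have wk : fix_above k.+2 (sg k.+1 * v * sg k.+1)%g.
  by move=> a ka; rewrite !pnM !pn_sg // (@swapD k.+1 a) ?vk ?swapD //; lia.
split=> //; split.
- by rewrite rk_Msg_neq // ?rk_sgM_neq //; lia.
- exact: avoids_fix_above.
- rewrite !flipM !flip_sg //.
  by apply: avoids_Msg_low; [lia | lia | apply: avoids_sgM_low; lia || exact: a2].
Qed.

Lemma good_conj2 k v : k.+3 < n -> fix_above k.+1 v -> good k v ->
  let w := (sg k.+1 * v * sg k.+2 * sg k.+1)%g in fix_above k.+3 w /\ good k w.
Proof.
move=> kn vk [rv a1 a2] w; have kn2 := ltnW kn; have kn1 := ltnW kn2.
have wk : fix_above k.+3 w.
  move=> a ka; rewrite !pnM !pn_sg // (@swapD k.+1 a); try lia.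
  by rewrite vk ?swapD //; lia.
split=> //; split.
- by rewrite !rk_Msg_neq // ?rk_sgM_neq //; lia.
- move=> j kj jn; have [jE|jE] := eqVneq j k.+1; last first.
    have := rk_pattern kj jn; move=> [r1 _].
    by split=> /(_ j.+1 j.+2); rewrite ?(fix_above_rk wk) ?(fix_above_rk (fix_aboveV wk)); lia.
  subst j; have r : 0 < rk (pn (sg k * trs k.+1)%g) k.+1 k.+3.
    rewrite rk_sgM // pn_trs //.
    by eval_swap; lia.
  (* For j = k + 1 the pattern has positive rank at (k + 1, k + 3), but a product of this shape
     sends no position up to k that far. *)
  have r0 u : fix_above k.+1 u -> rk (pn (sg k.+1 * u * sg k.+2 * sg k.+1)%g) k.+1 k.+3 = 0.
    move=> uk; apply: rk_eq0 => a ak; have := fix_above_le uk (ltnW ak).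
    by rewrite !pnM !pn_sg // (@swapD k.+1 a); [move=> ua; eval_swap; lia|lia|lia].
  (* The inverse has the same shape since s_{k+2} commutes with the inverse of [v], which fixes all
     points above k + 1. *)
  have wV : (w^-1 = sg k.+1 * v^-1 * sg k.+2 * sg k.+1)%g.
    rewrite /w !inv_Msg inv_sgM !mulgA; congr (_ * _)%g; rewrite -!mulgA; congr (_ * _)%g.
    apply: eq_pn => a; rewrite !pnM !pn_sg //; have vV := fix_aboveV vk.
    have [ak|ka] := leqP a k.+1.
      by rewrite !swapD //; have := fix_above_le vV ak; lia.
    by rewrite !vV //; eval_swap; lia.
  split=> /(_ k.+1 k.+3); first by rewrite r0 //; lia.
  by rewrite wV r0; [lia | apply: fix_aboveV].
- rewrite !flipM !flip_sg //.
  by do ![apply: avoids_Msg_low; [lia | lia |]]; apply: avoids_sgM_low; lia || exact: a2.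
Qed.

End GoodProducts.

(** * Counting good permutations by their last moved point *)

Section Counting.

Variable n : nat.
Implicit Types u v w x : 'S_n.
Local Notation sg := (sg n).

Definition fix_below l w := forall a, a < l -> pn w a = a.

(** The lower bound l stays frozen while the recursion runs over m. *)
Definition good_between l k m : {set 'S_n} :=
  [set w | `[< [/\ good k w, fix_above m w & fix_below l w] >]].

Lemma good_betweenP l k m w :
  reflect [/\ good k w, fix_above m w & fix_below l w] (w \in good_between l k m).
Proof. by rewrite inE; apply: asboolP. Qed.

Lemma fix_belowV l w : fix_below l w -> fix_below l w^-1%g.
Proof. by move=> wl a /wl {1}<-; rewrite pnK. Qed.

Lemma fix_below_sgM l m w : l <= m -> m.+1 < n -> fix_below l w -> fix_below l (sg m * w)%g.
Proof. by move=> lm mn wl a al; rewrite pn_sgM //= swapD ?wl //; lia. Qed.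

Lemma fix_below_Msg l m w : l <= m -> m.+1 < n -> fix_below l w -> fix_below l (w * sg m)%g.
Proof.
by move=> lm mn /fix_belowV wl; rewrite -(invgK (_ * _)%g) inv_Msg; apply/fix_belowV/fix_below_sgM.
Qed.

Lemma fix_above_leq m m' w : m <= m' -> fix_above m w -> fix_above m' w.
Proof. by move=> mm wm a ma; apply: wm; lia. Qed.

Lemma good_moves k w : good k w -> ~ fix_above k w.
Proof. by move=> [wk _ _] wf; move: wk; rewrite (fix_above_rk wf). Qed.

Lemma good_between_base l k : good_between l k k = set0.
Proof.
by apply/setP => w; rewrite in_set0; apply/good_betweenP => -[/good_moves].
Qed.

(** * The recursion on the letters above s_k *)

Section Recursion.

Variables (l k : nat).
Hypothesis lk : l <= k.

Local Notation C := (good_between l k).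

Lemma good_betweenV m w : k.+1 < n -> w \in C m -> w^-1%g \in C m.
Proof.
move=> kn /good_betweenP[gw wm wl]; apply/good_betweenP.
by split; [apply: goodV | apply: fix_aboveV | apply: fix_belowV].
Qed.

(** Left multiplication by s_m is a bijection, by [peel_left] one way and [good_sgM_new] the
    other. *)
Lemma card_left_descent m : k < m -> m.+1 < n ->
  #|[set w in C m.+1 | pn w m == m.+1]| = #|C m|.
Proof.
move=> km mn; rewrite -(card_imset (mem (C m)) (mulgI (sg m))); congr #|pred_of_set _|.
apply/setP => w; rewrite !inE; apply/andP/imsetP => [[/asboolP[gw wm wl] /eqP wE]|].
  exists (sg m * w)%g; last by rewrite sgKl.
  have wmm : pn w m.+1 != m.+1 by apply/eqP => e; have /pn_inj := etrans e (esym wE); lia.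
  have [[gv _ _ _] vm] := peel_left km mn gw wm wmm wE.
  by apply/good_betweenP; split=> //; apply: fix_below_sgM => //; lia.
move=> [v /good_betweenP[gv vm vl] ->]; split.
  apply/asboolP; split; [exact: good_sgM_new | exact: fix_above_sgM |].
  by apply: fix_below_sgM => //; lia.
by rewrite pn_sgM //= swapL vm.
Qed.

Lemma card_right_descent m : k < m -> m.+1 < n ->
  #|[set w in C m.+1 | pn w m.+1 == m]| = #|C m|.
Proof.
move=> km mn; have kn : k.+1 < n by lia.
rewrite -(card_left_descent km mn) -(card_imset _ (@invg_inj _)); congr #|pred_of_set _|.
apply/setP => w; apply/imsetP/idP => [[v + ->]|].
  move=> /setIdP[vC /eqP vE]; apply/setIdP; split; first exact: good_betweenV.
  by rewrite -{1}vE pnK.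
move=> /setIdP[wC /eqP wE]; exists w^-1%g; last by rewrite invgK.
apply/setIdP; split; first exact: good_betweenV.
by rewrite -{1}wE pnK.
Qed.

(** Now [w] exchanges m and m + 1, so s_m w fixes m as well. *)
Lemma card_both_descents m : k < m -> m.+1 < n ->
  #|[set w in C m.+1 | (pn w m == m.+1) && (pn w m.+1 == m)]| = #|C m.-1|.
Proof.
move=> km mn; rewrite -(card_imset (mem (C m.-1)) (mulgI (sg m))); congr #|pred_of_set _|.
apply/setP => w; rewrite inE.
apply/andP/imsetP => [[/good_betweenP[gw wm wl] /andP[/eqP wE /eqP wE']]|].
  exists (sg m * w)%g; last by rewrite sgKl.
  have wmm : pn w m.+1 != m.+1 by apply/eqP => e; have /pn_inj := etrans e (esym wE); lia.
  have [[gv _ _ _] vm] := peel_left km mn gw wm wmm wE.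
  apply/good_betweenP; split=> //; last by apply: fix_below_sgM => //; lia.
  move=> a; have [->|am] := eqVneq a m; first by rewrite pn_sgM //= swapL wE'.
  by move=> ma; apply: vm; lia.
move=> [v /good_betweenP[gv vm vl] ->]; have vm' := fix_above_leq (leq_pred m) vm.
split; last by rewrite !pn_sgM //= swapL swapR !vm ?eqxx //; lia.
apply/good_betweenP; split; [exact: good_sgM_new | exact: fix_above_sgM |].
by apply: fix_below_sgM => //; lia.
Qed.

(** The remaining class: m + 1 is moved, and neither its image nor its preimage is m. *)
Definition no_descent (m : nat) :=
  [set w in C m.+1 | (pn w m.+1 < m) && (pn w^-1%g m.+1 < m)].

Lemma card_setIdE (T : finType) (S : {set T}) (P : pred T) :
  #|[set x in S | P x]| = \sum_(x in S) P x.
Proof.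
by rewrite -sum1dep_card big_mkcondr; apply: eq_bigr => x _; case: (P x).
Qed.

Lemma card_fixed (m : nat) : #|[set w in C m.+1 | pn w m.+1 == m.+1]| = #|C m|.
Proof.
congr #|pred_of_set _|; apply/setP => w; rewrite inE.
apply/andP/good_betweenP => [[/good_betweenP[gw wm wl] /eqP wE]|[gw wm wl]].
  split=> // a; rewrite leq_eqVlt => /orP[/eqP <- //|]; exact: wm.
split; last by rewrite wm.
by apply/good_betweenP; split=> //; apply: fix_above_leq wm.
Qed.

(** Inclusion and exclusion: m + 1 is fixed, or has preimage m, or has image m, three classes of the
    same size of which the last two overlap, or lies in [no_descent]. *)
Lemma good_between_succ m : k < m -> m.+1 < n ->
  #|C m.+1| + #|C m.-1| = 3 * #|C m| + #|no_descent m|.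
Proof.
move=> km mn; rewrite -(card_both_descents km mn).
rewrite (_ : 3 * #|C m| = #|C m| + #|C m| + #|C m|); last by lia.
rewrite -{1}(card_fixed m) -{1}(card_left_descent km mn) -(card_right_descent km mn).
rewrite /no_descent !card_setIdE -sum1_card -!big_split /=.
apply: eq_bigr => w /good_betweenP[_ wm _].
have p_le := fix_above_le wm (leqnn _); have q_le := fix_above_le (fix_aboveV wm) (leqnn _).
have p_q : (pn w m.+1 == m.+1) = (pn w^-1%g m.+1 == m.+1).
  by apply/eqP/eqP => e; rewrite -{1}e ?pnK ?pnKV.
have q_m : (pn w m == m.+1) = (pn w^-1%g m.+1 == m).
  by apply/eqP/eqP => e; rewrite -{1}e ?pnK ?pnKV.
have pm : pn w m <> pn w m.+1 by apply/eqP; apply: pn_neqS.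
by move: p_q; rewrite q_m; lia.
Qed.

Lemma good_between_le w : w \in C k.+1 -> pn w k.+1 <= k.
Proof.
move=> /good_betweenP[gw wm _]; have := fix_above_le wm (leqnn _).
rewrite leq_eqVlt => /orP[/eqP e|]; last by rewrite ltnS.
case: (good_moves gw) => a; rewrite leq_eqVlt => /orP[/eqP <- //|]; exact: wm.
Qed.

(** Conjugation by s_{k+1} is the bijection, from [peel_conj1] and [good_conj1]. *)
Lemma card_no_descent1 : k.+2 < n -> #|no_descent k.+1| = #|C k.+1|.
Proof.
move=> kn; have kn1 := ltnW kn; pose f w : 'S_n := (sg k.+1 * w * sg k.+1)%g.
have fK : involutive f by move=> w; rewrite /f !mulgA sgK mul1g sgKr.
rewrite -(card_imset (mem (C k.+1)) (inv_inj fK)); congr #|pred_of_set _|.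
apply/setP => w; rewrite inE; apply/andP/imsetP => [[/good_betweenP[gw wm wl] /andP[p q]]|].
  exists (f w); last by rewrite fK.
  have [[gv _ _ _] vm] := peel_conj1 kn gw wm p q.
  by apply/good_betweenP; split=> //; apply: fix_below_Msg; [lia | lia |];
    apply: fix_below_sgM; lia || exact: wl.
have low v : v \in C k.+1 -> pn (f v) k.+2 < k.+1.
  move=> vC; have := good_between_le vC.
  by rewrite /f !pnM !pn_sg // swapR => vk; rewrite swapD; lia.
move=> [v vC ->]; have /good_betweenP[gv vm vl] := vC.
have [fm gf] := good_conj1 kn vm gv.
split.
  by apply/good_betweenP; split=> //; apply: fix_below_Msg; [lia | lia |];
    apply: fix_below_sgM; lia || exact: vl.
rewrite low //; have -> : ((f v)^-1 = f v^-1)%g by rewrite /f inv_Msg inv_sgM mulgA.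
by rewrite low //; apply: good_betweenV.
Qed.

Lemma card_no_descent2 : k.+3 < n -> #|no_descent k.+2| = #|C k.+1|.
Proof.
move=> kn; have kn2 := ltnW kn; have kn1 := ltnW kn2.
pose f w : 'S_n := (sg k.+1 * w * sg k.+2 * sg k.+1)%g.
have finj : injective f by move=> v w /mulIg/mulIg/mulgI.
rewrite -(card_imset (mem (C k.+1)) finj); congr #|pred_of_set _|.
apply/setP => w; rewrite inE; apply/andP/imsetP => [[/good_betweenP[gw wm wl] /andP[p q]]|].
  have [e|[_ p' q']] := no_descent_cases (leqW (ltnSn k)) kn gw wm p q; first by lia.
  have [[gv _ _ _] vm] := peel_conj2 kn gw wm p' q'.
  exists (sg k.+1 * w * sg k.+1 * sg k.+2)%g; last by rewrite /f !mulgA sgK mul1g !sgKr.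
  apply/good_betweenP; split=> //; do 2 ?[apply: fix_below_Msg; [lia | lia |]].
  by apply: fix_below_sgM; lia || exact: wl.
move=> [v /good_betweenP[gv vm vl] ->]; have [fm gf] := good_conj2 kn vm gv.
have p : pn (f v) k.+3 = k.+1.
  by rewrite /f !pnM !pn_sg // (@swapD k.+1 k.+3) ?vm ?swapR //; lia.
have q : pn (f v)^-1%g k.+3 = k.+1.
  suff e : pn (f v) k.+1 = k.+3 by rewrite -{1}e pnK.
  by rewrite /f !pnM !pn_sg // swapL vm // swapL swapD //; lia.
split; last by rewrite p q; lia.
apply/good_betweenP; split=> //; do 2 ?[apply: fix_below_Msg; [lia | lia |]].
by apply: fix_below_sgM; lia || exact: vl.
Qed.

Lemma card_no_descent3 m : k.+2 < m -> m.+1 < n -> #|no_descent m| = 0.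
Proof.
move=> km mn; apply: eq_card0 => w; rewrite inE; apply/negP.
move=> /andP[/good_betweenP[gw wm _] /andP[p q]].
have km' : k < m by lia.
by have [|[]] := no_descent_cases km' mn gw wm p q; lia.
Qed.

(* The factor contributed by the r letters on one side of s_k. *)
Definition side_count r := if r is 0 then 1 else 4 * fib (2 * r).

(** The identity F_{i+4} + F_i = 3 F_{i+2}. It starts at r + 1 because [side_count 0] is 1 and not 4
    F_0. *)
Lemma side_countS r : side_count r.+3 + side_count r.+1 = 3 * side_count r.+2.
Proof.
rewrite /side_count !mulnS !addSn !add0n.
have fibSS i : fib i.+2 = fib i.+1 + fib i by [].
by rewrite !fibSS; lia.
Qed.

(** For r = 1 the term for k is empty and [no_descent] adds one copy, giving 3 + 1 = 4; for r = 2
    the copy from [no_descent] cancels the subtracted one, giving 3 times 4; from then on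
    [no_descent] is empty. *)
Lemma card_good_between r : k.+1 + r < n ->
  #|C (k.+1 + r)| = side_count r * #|C k.+1|.
Proof.
have [N] := ubnP r; elim: N r => // N IHN [|[|[|r]]] rN rn.
- by rewrite addn0 mul1n.
- rewrite addn1 in rn *; have := good_between_succ (ltnSn k) rn.
  by rewrite card_no_descent1 // good_between_base cards0 /side_count /=; lia.
- have kk : k < k.+2 by lia.
  have rn' : k.+3 < n by lia.
  have rn1 : k.+1 + 1 < n by lia.
  rewrite addn2; have := good_between_succ kk rn'.
  have := IHN 1 rN rn1; rewrite addn1 => ->.
  by rewrite card_no_descent2 // /side_count /=; lia.
have km : k < k.+1 + r.+2 by lia.
have mn : (k.+1 + r.+2).+1 < n by lia.
have := good_between_succ km mn; rewrite card_no_descent3 //; last by lia.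
have -> : (k.+1 + r.+2).+1 = k.+1 + r.+3 by lia.
have -> : (k.+1 + r.+2).-1 = k.+1 + r.+1 by lia.
rewrite (IHN r.+2) ?(IHN r.+1); try lia.
by have := side_countS r; nia.
Qed.

End Recursion.

Lemma card_good_singleton k : k.+1 < n -> #|good_between k k k.+1| = 1.
Proof.
move=> kn; apply/eqP/cards1P; exists (sg k); apply/setP => w; rewrite inE.
apply/good_betweenP/eqP => [[gw wm wl]|->].
  apply: good_supportE => // a ka; have [an|na] := ltnP a n; last by rewrite pn_out.
  by rewrite pn_flip // wl; lia.
split; first exact: good_sg.
  by move=> a ka; rewrite pn_sg // swapD; lia.
by move=> a ka; rewrite pn_sg // swapD; lia.
Qed.

(** Flipping turns the free points below k into free points above, where the recursion applies
    again. *)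
Lemma card_good_flip k : k.+1 < n ->
  #|good_between 0 k k.+1| = #|good_between (n - k.+2) (n - k.+2) n.-1|.
Proof.
move=> kn; rewrite -(card_imset _ (inv_inj (@flipK n))); congr #|pred_of_set _|.
apply/setP => w; apply/imsetP/good_betweenP => [[v + ->]|[gw wm wl]].
  move=> /good_betweenP[gv vm _]; split; first exact: good_flip.
    by move=> a an; rewrite pn_out //; lia.
  by move=> a ak; rewrite pn_flip; [rewrite vm; lia | lia].
have kE : n - (n - k.+2).+2 = k by lia.
exists (flip w); last by rewrite flipK.
apply/good_betweenP; split=> //.
  by rewrite -[X in good X]kE; apply: good_flip => //; lia.
move=> a ka; have [an|na] := ltnP a n; last by rewrite pn_out.
by rewrite pn_flip // wl; lia.
Qed.

(** The recursion runs once over the n - k - 2 letters above s_k and, after flipping, once over the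
    k letters below; s_k alone remains. *)
Lemma card_good k : k.+1 < n ->
  #|[set w : 'S_n | `[< good k w >]]| = side_count (n - k.+2) * side_count k.
Proof.
move=> kn.
have -> : [set w : 'S_n | `[< good k w >]] = good_between 0 k n.-1.
  apply/setP => w; rewrite inE; apply/asboolP/good_betweenP => [gw|[]//].
  by split=> // a an; rewrite pn_out //; lia.
have {1}-> : n.-1 = k.+1 + (n - k.+2) by lia.
rewrite card_good_between //; last by lia.
rewrite card_good_flip //; have -> : n.-1 = (n - k.+2).+1 + k by lia.
rewrite card_good_between ?card_good_singleton ?muln1 //; lia.
Qed.

(** Here k counts from 0. An empty side contributes the factor 1, which accounts for the boundary
    case. *)
Lemma boolean_interval_numberE k : k.+1 < n -> 2 < n ->
  side_count (n - k.+2) * side_count k = boolean_interval_number n k.+1.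
Proof.
have side0 : side_count 0 = 1 by [].
have sideS r : 0 < r -> side_count r = 4 * fib (2 * r) by case: r.
move=> kn n2; rewrite /boolean_interval_number.
have [->|k0] := posnP k.
  by rewrite side0 muln1 sideS ?eqxx; [congr (4 * fib _); lia | lia].
have [r0|r0] := posnP (n - k.+2).
  rewrite r0 side0 mul1n sideS //.
  by rewrite (_ : _ || _ = true); [congr (4 * fib _); lia | lia].
rewrite (_ : _ || _ = false) ?sideS //; last by lia.
have -> : 2 * k.+1 - 2 = 2 * k by lia.
have -> : 2 * (n - k.+1) - 2 = 2 * (n - k.+2) by lia.
by rewrite mulnACA [fib _ * _]mulnC mulnA.
Qed.

End Counting.

(** * From good permutations to the boolean intervals that they bound *)

Theorem theorem5p3 (n : nat) (n_gt2 : 2 < n) (k : nat) (i : 'I_n.-1)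
    (k_def : k = i.+1) :
  (forall I : {set 'S_n}, I \in bruhat_intervals_from (sigma i) ->
     (is_boolean (@bruhat n) I <-> is_modular_lattice (@bruhat n) I) /\
     (is_boolean (@bruhat n) I <-> is_distributive_lattice (@bruhat n) I)) /\
  #|[set I in bruhat_intervals_from (sigma i) | `[< is_boolean (@bruhat n) I >]]|
    = boolean_interval_number n k.
Proof.
have iln : i.+1 < n by have := ltn_ord i; lia.
split=> [I /imsetP[w + ->]|].
  rewrite inE sigma_sg => /bruhatP kw.
  by have [_ bm bd] := boolean_modular_good iln kw.
rewrite k_def -boolean_interval_numberE // -card_good // sigma_sg.
(* An interval determines its top element, so counting intervals amounts to counting good
   permutations. *)
have itv_inj : {in [set w : 'S_n | `[< good i w >]] &, injective (bruhat_interval (sg n i))}.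
  have kw w : w \in [set w : 'S_n | `[< good i w >]] -> bruhat (sg n i) w.
    by rewrite inE => /asboolP[wi _ _]; apply/bruhatP/ler_sgP; rewrite ?wi.
  have ww w : bruhat w w by apply/bruhatP; apply: ler_refl.
  move=> v w vg wg vw; apply: ler_anti; apply/bruhatP.
    have : v \in bruhat_interval (sg n i) v by rewrite inE kw // ww.
    by rewrite vw inE => /andP[].
  have : w \in bruhat_interval (sg n i) w by rewrite inE kw // ww.
  by rewrite -vw inE => /andP[].
rewrite -(card_in_imset itv_inj); congr #|pred_of_set _|.
apply/setP => I; rewrite inE; apply/andP/imsetP => [[/imsetP[w + ->] /asboolP bI]|[w + ->]].
  rewrite inE => /bruhatP kw; have [bg _ _] := boolean_modular_good iln kw.
  by exists w => //; rewrite inE; apply/asboolP/bg.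
rewrite inE => /asboolP gw; have kw : ler (sg n i) w.
  by apply/ler_sgP => //; have [-> _ _] := gw.
have [bg _ _] := boolean_modular_good iln kw.
by split; [apply: imset_f; rewrite inE; apply/bruhatP | apply/asboolP/bg].
Qed.
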